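(* There is an absolute constant $C>0$ such that the following holds. Let $T,\theta>0$, let $\alpha_0>0$ and $\Delta_\alpha\ge0$ satisfy $\alpha_0-\Delta_\alpha>0$, and let $\alpha\in[\alpha_0-\Delta_\alpha,\alpha_0+\Delta_\alpha]$. Let $\Omega\ge 1$ and $\Delta_{\mathcal C}\ge 0$, and let $\mathcal{C}$ be a (not necessarily linear) class of signals such that: (M1) each $f\in\mathcal{C}$ has an integrable Fourier transform and has bandwidth $\Omega$ up to tolerance $\theta$; (M2) for each $f\in\mathcal{C}$, $\Delta_{\mathrm{past}}(f)\le\Delta_{\mathcal C}$ and $\Delta_{\mathrm{future}}(f)\le\Delta_{\mathcal C}$. Assume that $\alpha_0+\Delta_\alpha\le\Omega$. Let $f_1,f_2\in\mathcal{C}$ be measured on the observation window $[0,T]$ by a leaky integrate-and-fire sampler with firing threshold $\theta$ and leakage $\alpha$. Suppose that $f_1$ and $f_2$ each produce $n$ spikes, located at $t_1<\dots<t_n$ and $t_1'<\dots<t_n'$ respectively, with the same firing phases $q_1,\dots,q_n$. Set $\Delta_t:=\sum_{j=1}^n|t_j-t_j'|$, $\sigma:=\log^+(\Delta_{\mathcal C}/\theta)$, and $$T_1=\frac{\sigma}{\alpha_0-\Delta_\alpha}+\frac{4}{\Omega}\sigma^2,\qquad T_2=T-\frac4\Omega\sigma^2.$$ Then $$\|f_1-f_2\|_{L^\infty[T_1,T_2]}\le C\,\theta\,\Omega\Big[1+n\,\frac{\Delta_\alpha}{\alpha_0-\Delta_\alpha}+\Delta_t\,n\,\Omega\Big].$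$
   Context: **Signals.** A signal is a bounded measurable function $f:\mathbb{R}\to\mathbb{C}$. The Fourier transform is normalized by $\hat f(\xi)=\int_{\mathbb{R}} f(x)e^{-2\pi i\xi x}\,dx$ (understood in the distributional sense if needed). $f$ has bandwidth $\Omega>0$ up to tolerance $\theta$ if $\int_{|\xi|>\Omega}|\hat f(\xi)|\,d\xi\le\theta$. **Leaky integrate-and-fire sampler** with threshold $\theta>0$ and leakage $\alpha>0$ on $[0,T]$. Set $t_0:=0$. Given $t_{k-1}$, let $t_k$ be the minimum number in $[t_{k-1},T]$ with $\left|\int_{t_{k-1}}^{t_k} f(x)e^{\alpha(x-t_k)}\,dx\right|=\theta$, provided such a number exists; otherwise the process stops. This gives finitely many firing times (spikes) $0\le t_1<\dots<t_n\le T$ (possibly $n=0$). The firing phases are the unimodular numbers $q_j:=\int_{t_{j-1}}^{t_j} f(x)e^{\alpha(x-t_j)}\,dx\Big/\left|\int_{t_{j-1}}^{t_j} f(x)e^{\alpha(x-t_j)}\,dx\right|$, $j=1,\dots,n$. **Past and future uncertainty** of a signal $f$, where $t_n$ denotes the last firing time of $f$ ($t_n=t_0=0$ if there is no firing): $$\Delta_{\mathrm{past}}(f):=\sup_{t\le 0,\ |\alpha'-\alpha_0|\le\Delta_\alpha}\left|\int_{-\infty}^t f(x)e^{\alpha'(x-t)}\,dx\right|,\qquad \Delta_{\mathrm{future}}(f):=\sup_{t>t_n,\ |\alpha'-\alpha_0|\le\Delta_\alpha}\left|\int_{t_n}^t f(x)e^{\alpha'(x-t)}\,dx\right|.$$ Here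 $\log^+(x)=\max\{0,\log x\}$ and $\log^+(0)=0$. *)

(* Defs.v *)
From HB Require Import structures.
From mathcomp Require Import all_boot all_order all_algebra.
From mathcomp Require Import all_classical all_reals all_analysis.
From mathcomp Require Import complex.
Import Order.TTheory GRing.Theory Num.Theory.
Import numFieldNormedType.Exports.

Set Implicit Arguments.
Unset Strict Implicit.
Unset Printing Implicit Defensive.

Local Open Scope classical_set_scope.
Local Open Scope ring_scope.
Local Open Scope complex_scope.

Section Signals.
Context {R : realType}.

Local Notation mu := (@lebesgue_measure R).

Implicit Types (f g : R -> R[i]) (D : set R).

(* [`|z|] on [R[i]] is complex-valued; this is the same modulus, valued in R. *)
Definition modulus (z : R[i]) : R := Normc.normc z.

(* The library integrates real-valued functions only; complex functions are
   treated through their real and imaginary parts. *)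
Definition cmeasurable f : Prop :=
  measurable_fun [set: R] (fun x => complex.Re (f x)) /\
  measurable_fun [set: R] (fun x => complex.Im (f x)).

Definition cintegrable f : Prop :=
  mu.-integrable [set: R] (EFin \o (fun x => complex.Re (f x))) /\
  mu.-integrable [set: R] (EFin \o (fun x => complex.Im (f x))).

Definition cintegral D f : R[i] :=
  (\int[mu]_(x in D) complex.Re (f x)) +i*
  (\int[mu]_(x in D) complex.Im (f x)).

Definition signal f : Prop :=
  cmeasurable f /\ exists M : R, forall x, modulus (f x) <= M.

Definition expi (x : R) : R[i] := cos x +i* sin x.

Definition fourier g (xi : R) : R[i] :=
  cintegral [set: R] (fun x => g x * expi (- (2 * pi * xi * x))).

Definition real_schwartz (h : R -> R) : Prop :=
  (forall (n : nat) (x : R), derivable (derive1n n h) x 1) /\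
  (forall k n : nat, exists M : R,
    forall x : R, `|x ^+ k * derive1n n h x| <= M).

Definition schwartz (phi : R -> R[i]) : Prop :=
  real_schwartz (fun x => complex.Re (phi x)) /\
  real_schwartz (fun x => complex.Im (phi x)).

(* [g] is an integrable function representing the tempered distribution
   \hat f, i.e. <\hat f, phi> := <f, \hat phi> = <g, phi>. A bounded [f] need
   not be integrable, so [fourier f] itself may be meaningless. *)
Definition integrable_fourier_transform f g : Prop :=
  cintegrable g /\
  forall phi, schwartz phi ->
    cintegral [set: R] (fun x => f x * fourier phi x) =
    cintegral [set: R] (fun xi => g xi * phi xi).

Definition has_bandwidth (Omega theta : R) f : Prop :=
  exists g, integrable_fourier_transform f g /\
    (\int[mu]_(xi in [set xi : R | (Omega < `|xi|)%R]) (modulus (g xi))%:E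
      <= theta%:E)%E.

(* \int_D f(x) e^{alpha (x - t)} dx *)
Definition leaky_integral (alpha : R) f D (t : R) : R[i] :=
  cintegral D (fun x => f x * (expR (alpha * (x - t)))%:C).

Definition crossings (theta alpha T : R) f (s : R) : set R :=
  [set t | s <= t <= T /\
           modulus (leaky_integral alpha f `[s, t] t) = theta].

(* [nth 0 (0 :: s) k] is t_k, including t_0 = 0, for [s = [:: t_1; ..; t_n]]. *)
Definition firing_time (s : seq R) (k : nat) : R := nth 0 (0 :: s) k.

Definition last_firing_time (s : seq R) : R := firing_time s (size s).

(* [s] is the complete list of firing times: each one is the least crossing
   after its predecessor, and no crossing remains after the last one. *)
Definition lif_spikes (theta alpha T : R) f (s : seq R) : Prop :=
  (forall k : nat, (k < size s)%N ->
     let C := crossings theta alpha T f (firing_time s k) in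
     C (firing_time s k.+1) /\ lbound C (firing_time s k.+1)) /\
  crossings theta alpha T f (last_firing_time s) = set0.

(* [firing_phase alpha f s j] is q_{j+1}. *)
Definition firing_phase (alpha : R) f (s : seq R) (j : nat) : R[i] :=
  let I := leaky_integral alpha f
    `[firing_time s j, firing_time s j.+1] (firing_time s j.+1) in
  I / (modulus I)%:C.

Definition past_uncertainty (alpha0 Dalpha : R) f : \bar R :=
  ereal_sup [set y | exists t alpha' : R,
    [/\ t <= 0, `|alpha' - alpha0| <= Dalpha &
        y = (modulus (leaky_integral alpha' f `]-oo, t] t))%:E]].

(* Quantifying over [s] only names the firing times of [f], which are unique. *)
Definition future_uncertainty (theta alpha T alpha0 Dalpha : R) f : \bar R :=
  ereal_sup [set y | exists (s : seq R) (t alpha' : R),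
    [/\ lif_spikes theta alpha T f s, last_firing_time s < t,
        `|alpha' - alpha0| <= Dalpha &
        y = (modulus (leaky_integral alpha' f
               `[last_firing_time s, t] t))%:E]].

Definition logp (x : R) : R := Num.max 0 (ln x).

(* The L^oo norm on [a, b]; it is 0 when [b <= a]. *)
Definition Linfty_norm (a b : R) f : \bar R :=
  Lnorm (mrestr mu (measurable_itv `[a, b])) +oo%E
    (fun x => (modulus (f x))%:E).

End Signals.

(* Main.v *)
(* Both real components of a signal [f] are treated separately.  Let [u(t)] be
   the leaky integral of [f] over [(-oo, t]], so that [f = u' + alpha u].  The
   sampler determines [u] up to the threshold: between spikes [u] decays
   exponentially up to an error [theta], and each spike adds [theta q_j].  Hence
   on [ [sigma / alpha, T] ] the leaky integrals of the two signals differ by at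
   most [theta (4 + alpha Delta_t + m(t))], where [m(t)] counts the indices [j]
   with [t] between [t_j] and [t_j'].  Elsewhere [4 theta] becomes
   [2 theta + 4 Delta_C].

   To come back to [f], the triangle wave [sum_k (-1)^k sin((2k+1) y)/(2k+1)^2]
   is linear near [0], which gives an exact formula for [u' + alpha u] in terms of
   the samples [u(x +- (2k+1) h)] of a band-limited [u].  Multiplying the
   coefficients by sinc^m with [m ~ sigma] keeps the formula exact and makes the
   far coefficients smaller than [e^-sigma], which absorbs [Delta_C].  Finally
   [m(t)] has integral at most [Delta_t], so averaging the formula over the step
   [h] bounds its contribution by [theta Omega^2 Delta_t]. *)
Require Import Defs.
From mathcomp Require Import all_boot all_order all_algebra.
From mathcomp Require Import all_classical all_reals all_analysis.
From mathcomp Require Import complex.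
From mathcomp Require Import measurable_realfun ess_sup_inf lra ring.
Import Order.TTheory GRing.Theory Num.Theory.
Import numFieldNormedType.Exports.

Local Open Scope classical_set_scope.
Local Open Scope ring_scope.

(** * The smoothed triangle wave *)

(** The limiting wave is linear on [[-1, 1]], and this range is split in three: 1/4 is spent on the
    [m] averages of half-width [1 / (4 m)], 1/4 on an offset that makes the formula return [u]
    besides [u'], and 1/2 is left for the phase [2 pi xi h]. Hence steps [h] up to
    [1 / (4 pi Omega)]. Frequencies above [Omega] escape the formula. There it is only bounded, by a
    multiple of [Omega]; but the transform of [u] is that of [f] divided by [alpha + 2 i pi xi],
    which regains this factor, and the bandwidth tolerance leaves a multiple of [theta]. A fixed
    step would not do, since [m(t)] can be as large as [n] at the sampled points. All sums are
    finite. The truncation error is of order [1 / N] with a constant that depends on [alpha] and on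
    the two transforms, so [N] goes to infinity last, at a fixed point. The transform is given only
    as a distribution, so [f] equals the inverse transform almost everywhere; for [u] the analogous
    identity holds everywhere, and it supplies the continuity behind the analysis of spikes. *)

Section Derivatives.
Context {R : realType}.
Implicit Types (f g : R -> R) (x a b : R).

Lemma is_derive_add f g x a b : is_derive x 1 f a -> is_derive x 1 g b ->
  is_derive x 1 (fun y => f y + g y) (a + b).
Proof. by move=> fa gb; apply: (is_deriveD fa gb). Qed.

Lemma is_derive_mul f g x a b : is_derive x 1 f a -> is_derive x 1 g b ->
  is_derive x 1 (fun y => f y * g y) (a * g x + f x * b).
Proof.
move=> fa gb; have := is_deriveM fa gb.
by move=> /is_derive_eq; apply; rewrite /GRing.scale/= addrC [g x * a]mulrC.
Qed.

Lemma is_derive_scale c f x a : is_derive x 1 f a ->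
  is_derive x 1 (fun y => c * f y) (c * a).
Proof. by move=> fa; apply: (is_deriveZ c fa). Qed.

Lemma is_derive_cos_scale c x :
  is_derive x 1 (fun y => cos (c * y)) (- (c * sin (c * x))).
Proof.
have h : is_derive x 1 (fun y : R => c * y) (c * 1) by apply: is_derive_scale.
have := is_derive1_comp (is_derive_cos (c * x)) h.
by rewrite mulr1 mulNr mulrC.
Qed.

Lemma is_derive_sin_scale c x :
  is_derive x 1 (fun y => sin (c * y)) (c * cos (c * x)).
Proof.
have h : is_derive x 1 (fun y : R => c * y) (c * 1) by apply: is_derive_scale.
have := is_derive1_comp (is_derive_sin (c * x)) h.
by rewrite mulr1 mulrC.
Qed.

Lemma is_derive_sum_nat n (F : nat -> R -> R) (dF : nat -> R) x :
  (forall k, is_derive x 1 (F k) (dF k)) ->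
  is_derive x 1 (fun y => \sum_(0 <= k < n) F k y) (\sum_(0 <= k < n) dF k).
Proof.
move=> dFk; elim: n => [|n ih].
  rewrite big_geq// (_ : (fun y => _) = cst 0); first exact: is_derive_cst.
  by apply/funext => y; rewrite big_geq.
rewrite big_nat_recr//= (_ : (fun y => _) =
  (fun y => \sum_(0 <= k < n) F k y + F n y)); first exact: is_derive_add.
by apply/funext => y; rewrite big_nat_recr.
Qed.

Lemma MVT_within f (df : R -> R) a b : a <= b ->
  (forall x, a <= x <= b -> is_derive x 1 f (df x)) ->
  exists2 c, a <= c <= b & f b - f a = df c * (b - a).
Proof.
move=> ab dfx; have [||c cab ->] := @MVT_segment R f df a b ab.
- by move=> x; rewrite in_itv/= => /andP[/ltW ? /ltW ?]; apply: dfx; lra.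
- apply: derivable_within_continuous => x; rewrite in_itv/= => ?.
  by apply: ex_derive; exact: dfx.
- by exists c => //; move: cab; rewrite in_itv.
Qed.

Lemma mean_value_bound f (df : R -> R) (K r x : R) : 0 <= r -> `|x| <= r ->
  (forall y : R, `|y| <= r -> is_derive y 1 f (df y)) ->
  (forall y : R, `|y| <= r -> `|df y| <= K) -> `|f x - f 0| <= K * `|x|.
Proof.
move=> r0 xr dfx dfK; have [x0|/ltW x0] := leP 0 x.
  have [|c cx ->] := @MVT_within f df 0 x x0.
    by move=> y yx; apply: dfx; move: xr; rewrite !ger0_norm; lra.
  rewrite subr0 normrM ler_wpM2r//; apply: dfK.
  by move: xr; rewrite !ger0_norm; lra.
have [|c cx] := @MVT_within f df x 0 x0.
  by move=> y yx; apply: dfx; move: xr; rewrite !ler0_norm; lra.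
rewrite distrC => ->; rewrite sub0r normrM normrN ler_wpM2r//; apply: dfK.
by move: xr; rewrite !ler0_norm; lra.
Qed.

End Derivatives.

Section TriangleWave.
Context {R : realType}.
Implicit Types (x y a : R) (m k N : nat).

Definition odd_coef k : R := (2 * k + 1)%:R.

Lemma odd_coef_gt0 k : 0 < odd_coef k.
Proof. by rewrite ltr0n addn1. Qed.

Lemma odd_coef_ge1 k : 1 <= odd_coef k.
Proof. by rewrite /odd_coef ler1n addn1. Qed.

Lemma odd_coefE k : odd_coef k = 2 * k%:R + 1.
Proof. by rewrite /odd_coef natrD natrM. Qed.

(* The factor sinc^m is the effect of averaging m times over [-a, a]. *)
Definition wave_weight m a k : R :=
  (-1) ^+ k / odd_coef k ^+ 2 * (sin (odd_coef k * a) / (odd_coef k * a)) ^+ m.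

Definition wave m a N x : R :=
  \sum_(0 <= k < N) wave_weight m a k * sin (odd_coef k * x).

(** Derivative of the unsmoothed wave, [m = 0]. At 0 it is the partial sum of the Leibniz series for
    [pi / 4]. *)
Definition leibniz N x : R :=
  \sum_(0 <= k < N) (-1) ^+ k / odd_coef k * cos (odd_coef k * x).

(** Slope at 0 of the unsmoothed wave. It serves for every [m], because symmetric averages preserve
    linear functions. *)
Definition slope N : R := leibniz N 0.

Lemma slopeE N : slope N = \sum_(0 <= k < N) (-1) ^+ k / odd_coef k.
Proof. by apply: eq_bigr => k _; rewrite mulr0 cos0 mulr1. Qed.

(** With an even number of terms the alternating sum splits into positive pairs, and the first pair
    is already 2/3. *)
Lemma slope_ge_half n : 1 / 2 <= slope n.+1.*2.
Proof.
elim: n => [|n ih].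
  rewrite slopeE big_nat_recr//= big_nat1 expr0 expr1 /odd_coef/=.
  rewrite muln0 muln1 !addn1; lra.
rewrite (le_trans ih)// [X in _ <= slope X](_ : _ = n.+1.*2.+2)//.
rewrite !slopeE (big_nat_recr n.+1.*2.+1)//= (big_nat_recr n.+1.*2)//= -addrA.
rewrite lerDl exprS -mul2n exprM sqrrN !expr1n mul1r mulr1 mulN1r subr_ge0.
by rewrite lef_pV2 ?posrE ?odd_coef_gt0// ler_nat leq_add2r leq_mul2l leqnSn.
Qed.

(** Telescoping: [2 cos x sin((2k+1)x) = sin((2k+2)x) + sin(2kx)], with alternating signs. *)
Lemma sum_alternating_sin N x :
  2 * cos x * (\sum_(0 <= k < N) (-1) ^+ k * sin (odd_coef k * x)) =
  - (-1) ^+ N * sin (2 * N%:R * x).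
Proof.
elim: N => [|N ih]; first by rewrite big_geq// !mulr0 mul0r sin0 mulr0.
rewrite big_nat_recr//= mulrDr ih exprS odd_coefE.
have -> : 2 * N.+1%:R * x = (2 * N%:R + 1) * x + x by rewrite -natr1; ring.
have -> : 2 * N%:R * x = (2 * N%:R + 1) * x - x by ring.
rewrite sinB sinD; ring.
Qed.

Lemma is_derive_leibniz N x : is_derive x 1 (leibniz N)
  (- \sum_(0 <= k < N) (-1) ^+ k * sin (odd_coef k * x)).
Proof.
rewrite raddf_sum/=; apply: is_derive_sum_nat => k.
have := is_derive_scale ((-1) ^+ k / odd_coef k) _ _ _
  (is_derive_cos_scale (odd_coef k) x).
move/is_derive_eq; apply; have := lt0r_neq0 (odd_coef_gt0 k).
by move: (odd_coef k) => c c0; field.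
Qed.

Lemma is_derive_wave m a N x : is_derive x 1 (wave m a N)
  (\sum_(0 <= k < N) wave_weight m a k * (odd_coef k * cos (odd_coef k * x))).
Proof.
by apply: is_derive_sum_nat => k; exact/is_derive_scale/is_derive_sin_scale.
Qed.

Lemma cos_ge_cos1 x : `|x| <= 1 -> cos 1 <= cos x.
Proof.
move=> x1; rewrite -(cos_norm x).
have [->//|n1] := eqVneq `|x| 1.
have p2 := @pi_ge2 R.
have x1' : `|x| < 1 by rewrite lt_neqAle n1.
by rewrite ltW// ltr_cos// in_itv/=; move: (normr_ge0 x); lra.
Qed.

(** The derivative of [leibniz] is [sin(M y) / (2 cos y)] with [M = 2 N]: not small, but rapidly
    oscillating. The correction term in [E] is the boundary term of an integration by parts; it
    cancels this oscillation and leaves a derivative of order [1 / M]. The range [|x| <= 1] keeps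
    [cos] above [cos 1 > 0]. *)
Lemma leibniz_flat n x : (0 < n)%N -> `|x| <= 1 ->
  `|leibniz n.*2 x - slope n.*2| <= (cos 1) ^- 2 / n.*2%:R.
Proof.
move=> n0 x1; set N := n.*2; set q : R := cos 1.
have q0 : 0 < q := cos1_gt0 R.
have N0 : 0 < N%:R :> R by rewrite ltr0n double_gt0.
have qcos y : `|y| <= 1 -> q <= cos y := @cos_ge_cos1 y.
pose M : R := 2 * N%:R.
have M0 : 0 < M by rewrite mulr_gt0.
have M0' := ltW M0; have q0' := ltW q0.
pose E y := leibniz N y + (2 * M)^-1 * (cos (M * y) * (cos y)^-1).
have dE (y : R) : `|y| <= 1 ->
    is_derive y 1 E (cos (M * y) * sin y / (2 * M * cos y ^+ 2)).
  move=> /qcos qy; have cy : cos y != 0 by rewrite gt_eqF// (lt_le_trans q0).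
  have := is_derive_add _ _ _ _ _ (is_derive_leibniz N y)
    (is_derive_scale (2 * M)^-1 _ _ _ (is_derive_mul _ _ _ _ _
      (is_derive_cos_scale M y) (is_deriveV cy (is_derive_cos y)))).
  move/is_derive_eq; apply; rewrite /GRing.scale/=.
  have := sum_alternating_sin N y.
  rewrite /N -signr_odd odd_double expr0 mulN1r -/N -/M => sumE.
  have -> : \sum_(0 <= k < N) (-1) ^+ k * sin (odd_coef k * y) =
      - sin (M * y) / (2 * cos y).
    by rewrite -sumE; field.
  by field; rewrite cy gt_eqF.
have dEb (y : R) : `|y| <= 1 ->
    `|cos (M * y) * sin y / (2 * M * cos y ^+ 2)| <= (2 * M * q ^+ 2)^-1.
  move=> /qcos qy; have cy : 0 < cos y by rewrite (lt_le_trans q0).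
  have cy' := ltW cy.
  rewrite normrM normrM -[leRHS]mul1r ler_pM ?mulr_ge0//.
    by rewrite mulr_ile1// ?cos_max ?sin_max.
  rewrite ger0_norm ?invr_ge0 ?mulr_ge0 ?sqr_ge0//.
  rewrite lef_pV2 ?posrE ?mulr_gt0 ?exprn_gt0//.
  by rewrite ler_wpM2l ?mulr_ge0// ler_sqr ?nnegrE//.
have := @mean_value_bound _ E _ _ _ _ ler01 x1 dE dEb.
rewrite /E mulr0 cos0 invr1 !mulr1.
have qx := qcos _ x1; have cx : 0 < cos x by rewrite (lt_le_trans q0).
have cx' := ltW cx.
have q1 : q <= 1 := cos_le1 1.
have h1 : `|(2 * M)^-1 * (cos (M * x) * (cos x)^-1)| <= (2 * M)^-1 * q ^- 2.
  rewrite normrM ger0_norm ?invr_ge0 ?mulr_ge0//.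
  rewrite ler_wpM2l ?invr_ge0 ?mulr_ge0// normrM -[leRHS]mul1r.
  rewrite ler_pM ?cos_max// ger0_norm ?invr_ge0//.
  rewrite lef_pV2 ?posrE ?exprn_gt0// (le_trans _ qx)//.
  by rewrite expr2 ler_piMl//.
have h2 : (2 * M)^-1 <= (2 * M)^-1 * q ^- 2.
  rewrite ler_peMr ?invr_ge0 ?mulr_ge0// invf_ge1 ?exprn_gt0//.
  by rewrite expr_le1//.
have h3 : (2 * M * q ^+ 2)^-1 * `|x| <= (2 * M)^-1 * q ^- 2.
  by rewrite -invfM ler_piMr ?invr_ge0 ?mulr_ge0 ?sqr_ge0.
have -> : q ^- 2 / N%:R = 4 * ((2 * M)^-1 * q ^- 2).
  by rewrite /M; field; rewrite gt_eqF// gt_eqF.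
rewrite /slope -/N; move: h1 h2 h3.
set u := _ * (cos _ * _); set v := (2 * M)^-1; set w := _ * q ^- 2.
set z := _ * `|x|; move=> h1 h2 h3 h4.
have v0 : 0 <= v by rewrite invr_ge0 mulr_ge0.
have -> : leibniz N x - leibniz N 0 =
  (leibniz N x + u - (leibniz N 0 + v)) - u + v by ring.
rewrite (le_trans (ler_normD _ _))// (ger0_norm v0).
rewrite (le_trans (lerD (ler_normB _ _) (lexx _)))//. lra.
Qed.

(** For [m = 0] this integrates [leibniz_flat]. The wave of order [m+1] at [x] is the mean of the
    wave of order [m] over [[x-a, x+a]], and a linear function equals its symmetric means, so each
    averaging keeps the error and costs [a] of the range. *)
Lemma wave_linear n m a x : (0 < n)%N -> 0 < a -> `|x| + m%:R * a <= 1 ->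
  `|wave m a n.*2 x - slope n.*2 * x| <= (cos 1) ^- 2 / n.*2%:R.
Proof.
move=> n0 a0; set N := n.*2.
have id_scale c (y : R) : is_derive y 1 (fun z => c * z) c.
  by have := is_derive_scale c _ _ _ (is_derive_id y 1); rewrite mulr1.
elim: m x => [|m ih] x.
  rewrite mul0r addr0 => x1.
  have dw (y : R) : is_derive y 1 (fun z => wave 0 a N z + (- slope N) * z)
      (leibniz N y - slope N).
    have := is_derive_add _ _ _ _ _ (is_derive_wave 0 a N y)
      (id_scale (- slope N) y).
    move/is_derive_eq; apply; congr (_ + _); apply: eq_bigr => k _.
    rewrite /wave_weight expr0 mulr1; have := lt0r_neq0 (odd_coef_gt0 k).
    by move: (odd_coef k) => c c0; field.
  have flat (y : R) : `|y| <= 1 ->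
      `|leibniz N y - slope N| <= cos 1 ^- 2 / N%:R by exact: leibniz_flat.
  have := mean_value_bound _ _ _ _ _ ler01 x1 (fun y _ => dw y) flat.
  have -> : wave 0 a N 0 = 0 by apply: big1 => k _; rewrite mulr0 sin0 mulr0.
  rewrite mulr0 addr0 mulNr subr0.
  by move/le_trans; apply; rewrite ler_piMr ?mulr_ge0 ?invr_ge0 ?sqr_ge0.
move=> xma.
(* An antiderivative of the deviation at order [m]. Its difference quotient over [[x-a, x+a]] is the
   deviation at order [m+1] at [x]; the mean value theorem turns it into a deviation at order
   [m]. *)
pose H y := \sum_(0 <= k < N)
    (- wave_weight m a k / odd_coef k) * cos (odd_coef k * y) +
  (- slope N / 2) * (y * y).
have dH (y : R) : is_derive y 1 H (wave m a N y - slope N * y).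
  have := is_derive_add _ _ _ _ _ (is_derive_sum_nat N _ _ y (fun k =>
    is_derive_scale (- wave_weight m a k / odd_coef k) _ _ _
      (is_derive_cos_scale (odd_coef k) y)))
    (is_derive_scale (- slope N / 2) _ _ _ (is_derive_mul _ _ _ _ _
      (is_derive_id y 1) (is_derive_id y 1))).
  move/is_derive_eq; apply; congr (_ + _); last by field.
  apply: eq_bigr => k _; have := lt0r_neq0 (odd_coef_gt0 k).
  by move: (odd_coef k) => c c0; field.
have [|c cx] := @MVT_within _ H _ (x - a) (x + a) _ (fun y _ => dH y); first lra.
have -> : H (x + a) - H (x - a) =
    2 * a * (wave m.+1 a N x - slope N * x).
  rewrite mulrBr mulr_sumr /H opprD addrACA -sumrB; congr (_ + _); last by field.
  apply: eq_bigr => k _; have k0 := lt0r_neq0 (odd_coef_gt0 k).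
  rewrite /wave_weight (exprSr _ m) mulrBr mulrDr cosD cosB.
  move: ((-1) ^+ k) (odd_coef k) k0 => e d d0.
  by move: ((_ / _) ^+ m) => P; field; rewrite d0 gt_eqF. 
have -> : x + a - (x - a) = 2 * a by ring.
rewrite mulrC => /mulIf ->; last by rewrite mulf_neq0// gt_eqF.
apply: ih; rewrite -natr1 mulrDl mul1r in xma.
have : `|c| <= `|x| + a; last by lra.
rewrite ler_norml; have := ler_norm x; have := ler_norm (- x); rewrite normrN.
by move: cx; lra.
Qed.

End TriangleWave.

(** * Integration and Gaussians *)

Section Integration.
Context {R : realType}.
Local Notation mu := (@lebesgue_measure R).
Local Notation integrableT f := (mu.-integrable [set: R] (EFin \o f)).
Implicit Types (f g h : R -> R) (D : set R).

Lemma integrable_measurable D f : mu.-integrable D (EFin \o f) ->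
  measurable_fun D f.
Proof. by move=> /measurable_int/measurable_EFinP. Qed.

Lemma integrable_ext D f g : f =1 g -> mu.-integrable D (EFin \o f) ->
  mu.-integrable D (EFin \o g).
Proof. by move=> /funext ->. Qed.

Lemma integrable_dominated D f g : measurable D -> measurable_fun D f ->
  (forall x, D x -> `|f x| <= g x) -> mu.-integrable D (EFin \o g) ->
  mu.-integrable D (EFin \o f).
Proof.
move=> mD mf fg; apply: le_integrable => //; first exact/measurable_EFinP.
by move=> x Dx /=; rewrite lee_fin (le_trans (fg x Dx))// ler_norm.
Qed.

Lemma integrable_scale D (c : R) f : measurable D ->
  mu.-integrable D (EFin \o f) ->
  mu.-integrable D (EFin \o (fun x => c * f x)).
Proof. by move=> mD fi; exact: (@integrableZl _ _ _ mu D mD c _ fi). Qed.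

Lemma integrable_bounded_mul D (M : R) f h : measurable D ->
  measurable_fun D h -> (forall x, D x -> `|h x| <= M) ->
  mu.-integrable D (EFin \o f) ->
  mu.-integrable D (EFin \o (fun x => f x * h x)).
Proof.
move=> mD mh hM fi.
have gi : mu.-integrable D (EFin \o (fun x => M * `|f x|)).
  by apply: integrable_scale => //; exact: integrable_norm.
apply: (integrable_dominated _ _ _ mD _ _ gi).
  by apply: measurable_funM => //; exact: integrable_measurable.
by move=> x Dx; rewrite normrM mulrC ler_wpM2r// hM.
Qed.

Lemma integrable_add D f g : measurable D -> mu.-integrable D (EFin \o f) ->
  mu.-integrable D (EFin \o g) ->
  mu.-integrable D (EFin \o (fun x => f x + g x)).
Proof. by move=> mD fi gi; exact: (@integrableD _ _ _ mu D mD _ _ fi gi). Qed.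

Lemma Rintegral_dominated_cvg D (f_ : nat -> R -> R) f g : measurable D ->
  (forall n, measurable_fun D (f_ n)) -> measurable_fun D f ->
  (forall x, D x -> f_ ^~ x @ \oo --> f x) ->
  (forall n x, D x -> `|f_ n x| <= g x) -> mu.-integrable D (EFin \o g) ->
  (\int[mu]_(x in D) f_ n x) @[n --> \oo] --> \int[mu]_(x in D) f x.
Proof.
move=> mD mf_ mf f_f f_g gi.
have [|||||fi _ fcvg] := @dominated_convergence _ _ _ mu D mD (fun n => EFin \o f_ n)
  (EFin \o f) (EFin \o g).
- by move=> n; exact: (measurable_EFinP _ _).2 (mf_ n).
- exact/measurable_EFinP.
- by apply: aeW => x Dx; apply: cvg_EFin; [exact: nearW|exact: f_f].
- exact: gi.
- by apply: aeW => x n Dx; rewrite lee_fin f_g.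
apply: fine_cvg; rewrite fineK; first exact: fcvg.
exact: (@integrable_fin_num _ _ _ mu D mD _ fi).
Qed.

Lemma is_derive_Rintegral (f df : R -> R -> R) (G : R -> R) (t : R) : integrableT G ->
  (forall s, integrableT (f s)) ->
  (forall s y : R, is_derive s 1 (f^~ y) (df s y)) ->
  (forall s y, `|df s y| <= G y) ->
  is_derive t 1 (fun s => \int[mu]_y f s y) (\int[mu]_y df t y).
Proof.
move=> Gi fi dfE dfG.
have G0 y : 0 <= G y by rewrite (le_trans _ (dfG 0 y)).
have It : `]t - 1, t + 1[%classic t by rewrite /= in_itv/=; lra.
have d1 s y : (f ^~ y)^`()%classic s = df s y.
  by rewrite derive1E; have [_ ->] := dfE s y.
apply: DeriveDef.
  apply: (@derivable_under_integral _ _ _ mu f setT measurableT t _ _ It _ _ G)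
    => //.
  by move=> s y _ _; rewrite /partial1of2 d1.
rewrite -derive1E.
rewrite (@differentiation_under_integral _ _ _ mu f setT measurableT t _ _ It
  _ _ G)//.
- by apply: eq_Rintegral => y _; rewrite /partial1of2 d1.
- by move=> s y _ _; rewrite /partial1of2 d1.
Qed.

Lemma Rintegral_derivative f df (a b : R) : a < b -> continuous df ->
  (forall x : R, is_derive x 1 f (df x)) ->
  \int[mu]_(x in `[a, b]) df x = f b - f a.
Proof.
move=> ab dfc fdf.
have fc x : f @ x --> f x.
  by apply/differentiable_continuous/derivable1_diffP/ex_derive.
rewrite /Rintegral (@continuous_FTC2 _ df f a b ab) -?EFinB//.
- exact: continuous_subspaceT.
- split=> [x _||]; [exact: ex_derive| |].
    exact/cvg_at_right_filter/fc.
  exact/cvg_at_left_filter/fc.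
- by move=> x _; rewrite derive1E; have [_ ->] := fdf x.
Qed.

(** The fundamental theorem on [[-(n+1), n+1]], then dominated convergence. The shift to [n.+1]
    keeps these intervals nondegenerate. *)
Lemma Rintegral_derivative0 f df : continuous df -> integrableT df ->
  (forall x : R, is_derive x 1 f (df x)) ->
  f n.+1%:R @[n --> \oo] --> (0 : R) -> f (- n.+1%:R) @[n --> \oo] --> (0 : R) ->
  \int[mu]_x df x = 0.
Proof.
move=> dfc dfi fdf f0 fN0.
pose I n : set R := `[(- n.+1%:R : R), n.+1%:R]%classic.
have h1 : (\int[mu]_x ((df \_ (I n)) x)) @[n --> \oo] --> \int[mu]_x df x.
  apply: (@Rintegral_dominated_cvg setT _ _ (fun x => `|df x|)) => //.
  - move=> n; apply/(measurable_restrictT _ _).1 => //.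
      exact: measurable_itv.
    by apply: measurable_funTS; exact: integrable_measurable.
  - exact: integrable_measurable.
  - move=> x _; apply: cvg_near_cst.
    near=> n; rewrite patchE ifT// inE /I/= in_itv/= -ler_norml.
    rewrite ltW// (lt_le_trans (archi_boundP (normr_ge0 x)))// ler_nat.
    by apply: leqW; near: n; exact: nbhs_infty_ge.
  - by move=> n x _; rewrite patchE; case: ifP => // _; rewrite normr0.
  - exact: integrable_norm.
have h2 : (\int[mu]_x ((df \_ (I n)) x)) @[n --> \oo] --> (0 - 0 : R).
  under eq_fun do rewrite -Rintegral_mkcond (Rintegral_derivative f) ?gtrN//.
  exact: cvgB.
by rewrite (cvg_unique _ h1 h2)// subr0.
Unshelve. all: by end_near. Qed.

End Integration.

(** * Gaussian integrals, and modulated Gaussians as Schwartz functions *)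

Section Gaussian.
Context {R : realType}.
Local Notation mu := (@lebesgue_measure R).
Local Notation integrableT f := (mu.-integrable [set: R] (EFin \o f)).
Implicit Types (x y s t c p : R) (P Q : {poly R}).

Lemma normal_pdf_expR m s x : s != 0 ->
  normal_pdf m s x = normal_peak s * expR (- ((x - m) ^+ 2 / (2 * s ^+ 2))).
Proof.
by move=> s0; rewrite normal_pdfE// /normal_fun mulNr mulrC -mulr_natl mulrC.
Qed.

Lemma normal_pdf0_expR s x : s != 0 ->
  normal_pdf 0 s x = normal_peak s * expR (- ((2 * s ^+ 2)^-1 * x ^+ 2)).
Proof. by move=> s0; rewrite normal_pdf_expR// subr0 [_ / _]mulrC. Qed.

Lemma is_derive_normal_pdf s x : s != 0 ->
  is_derive x 1 (normal_pdf 0 s) (- (x / s ^+ 2) * normal_pdf 0 s x).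
Proof.
move=> s0; rewrite (_ : normal_pdf 0 s = fun y =>
  normal_peak s * expR (- (2 * s ^+ 2)^-1 * (y * y))); last first.
  by apply/funext => y; rewrite normal_pdf0_expR// mulNr expr2.
have h := is_derive_scale (- (2 * s ^+ 2)^-1) _ _ _
  (is_derive_mul _ _ _ _ _ (is_derive_id x 1) (is_derive_id x 1)).
have := is_derive_scale (normal_peak s) _ _ _
  (is_derive1_comp (is_derive_expR _) h).
move/is_derive_eq; apply; move: (normal_peak _) (expR _) => u v /=.
by field.
Qed.

Lemma norm_le_expR_sqr c : 0 < c ->
  exists K : R, 0 <= K /\ forall x, `|x| <= K * expR (c * x ^+ 2).
Proof.
move=> c0; exists (1 + c^-1); split; first by rewrite addr_ge0// invr_ge0 ltW.
move=> x.
have h1 : `|x| <= 1 + x ^+ 2.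
  rewrite -real_normK ?num_real//; have := sqr_ge0 (`|x| - 1 / 2); rewrite sqrrB.
  by have := normr_ge0 x; have := sqr_ge0 `|x|; lra.
apply: (le_trans h1); apply: (@le_trans _ _ ((1 + c^-1) * (1 + c * x ^+ 2))).
  rewrite mulrDl mul1r mulrDr mulr1 mulKf ?gt_eqF//.
  have : 0 <= c^-1 by rewrite invr_ge0 ltW.
  have : 0 <= c * x ^+ 2 by rewrite mulr_ge0 ?sqr_ge0// ltW.
  lra.
by rewrite ler_wpM2l ?expR_ge1Dx// addr_ge0// invr_ge0 ltW.
Qed.

Lemma poly_gauss_bounded c P : 0 < c ->
  exists M : R, forall x, `|P.[x] * expR (- (c * x ^+ 2))| <= M.
Proof.
(* The extra factor [x ^+ j] is what the induction produces: [P * 'X + d] splits into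
   [x ^+ j.+1 * P] and a multiple of the monomial [x ^+ j]. *)
move=> c0; suff : forall j, exists M : R,
    forall x, `|x ^+ j * P.[x] * expR (- (c * x ^+ 2))| <= M.
  by move=> /(_ 0%N)[M PM]; exists M => x; have := PM x; rewrite expr0 mul1r.
elim/poly_ind: P => [j|P d ih j].
  by exists 0 => x; rewrite horner0 mulr0 mul0r normr0.
have [M1 h1] := ih j.+1.
suff [M2 h2] : exists M : R, forall x, `|x ^+ j * expR (- (c * x ^+ 2))| <= M.
  exists (M1 + M2 * `|d|) => x; rewrite hornerD hornerM hornerX hornerC mulrDr mulrDl.
  rewrite (le_trans (ler_normD _ _))// lerD//.
    rewrite (le_trans _ (h1 x))// (exprSr x j) le_eqVlt; apply/orP; left.
    by apply/eqP; congr `|_|; ring.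
  by rewrite mulrAC normrM ler_wpM2r.
(* The rate [c / (j+1)] is chosen so that the [j]-th power of this bound costs at most [exp(c x^2)];
   dividing by [j.+1] also covers [j = 0]. *)
have [K [K0 hK]] : exists K : R, 0 <= K /\
    forall x, `|x| <= K * expR (c / j.+1%:R * x ^+ 2).
  by apply: norm_le_expR_sqr; rewrite divr_gt0.
exists (K ^+ j) => x; rewrite normrM normrX (ger0_norm (expR_ge0 _)).
rewrite -ler_pdivlMr ?expR_gt0// expRN invrK.
apply: (@le_trans _ _ ((K * expR (c / j.+1%:R * x ^+ 2)) ^+ j)).
  by rewrite lerXn2r// ?nnegrE ?mulr_ge0 ?expR_ge0.
rewrite exprMn ler_wpM2l ?exprn_ge0// -expRM_natl ler_expR.
rewrite mulrA ler_wpM2r ?sqr_ge0//.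
by rewrite mulrCA ler_piMr ?(ltW c0)// ler_pdivrMr// mul1r ler_nat.
Qed.

(** The polynomial coefficients make this family stable under differentiation, so one bound on
    polynomials times Gaussians controls all derivatives. *)
Definition gauss_wave c s (P Q : {poly R}) x : R :=
  (P.[x] * cos (c * x) + Q.[x] * sin (c * x)) * normal_pdf 0 s x.

Lemma is_derive_gauss_wave c s P Q x : s != 0 ->
  is_derive x 1 (gauss_wave c s P Q)
    (gauss_wave c s (P^`() + c *: Q - (s ^- 2) *: ('X * P))
                    (Q^`() - c *: P - (s ^- 2) *: ('X * Q)) x).
Proof.
move=> s0; have := is_derive_mul _ _ _ _ _ (is_derive_add _ _ _ _ _
  (is_derive_mul _ _ _ _ _ (is_derive_poly P x) (is_derive_cos_scale c x))
  (is_derive_mul _ _ _ _ _ (is_derive_poly Q x) (is_derive_sin_scale c x)))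
  (is_derive_normal_pdf s x s0).
move/is_derive_eq; apply; rewrite /gauss_wave.
rewrite !(hornerD, hornerN, hornerZ, hornerM, hornerX).
by move: (normal_pdf _ _ _) => u; field.
Qed.

Lemma gauss_wave_derive1n c s n P Q : s != 0 ->
  exists P' Q', derive1n n (gauss_wave c s P Q) = gauss_wave c s P' Q'.
Proof.
move=> s0; elim: n => [|n [P' [Q' ih]]]; first by exists P, Q.
eexists; eexists; rewrite derive1nS ih; apply/funext => x.
by rewrite derive1E; have [_ ->] := is_derive_gauss_wave c s P' Q' x s0.
Qed.

Lemma real_schwartz_gauss_wave c s P Q : s != 0 ->
  real_schwartz (gauss_wave c s P Q).
Proof.
move=> s0; split=> [n x|k n].
  have [P' [Q' ->]] := gauss_wave_derive1n c s n P Q s0.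
  by apply: ex_derive; exact: is_derive_gauss_wave.
have [P' [Q' ->]] := gauss_wave_derive1n c s n P Q s0.
have c0 : 0 < (2 * s ^+ 2)^-1 by rewrite invr_gt0 mulr_gt0// exprn_even_gt0.
have [M hM] := poly_gauss_bounded _ ('X^k * P') c0.
have [N hN] := poly_gauss_bounded _ ('X^k * Q') c0.
exists (normal_peak s * (M + N)) => x.
rewrite /gauss_wave normal_pdf0_expR//; move: (hM x) (hN x).
rewrite !hornerM !hornerXn; set u := expR _ => hM' hN'.
have -> : x ^+ k * ((P'.[x] * cos (c * x) + Q'.[x] * sin (c * x)) *
    (normal_peak s * u)) = normal_peak s *
    ((x ^+ k * P'.[x] * u) * cos (c * x) + (x ^+ k * Q'.[x] * u) * sin (c * x)).
  ring.
rewrite normrM ger0_norm ?normal_peak_ge0// ler_wpM2l ?normal_peak_ge0//.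
rewrite (le_trans (ler_normD _ _))// lerD// normrM.
  by rewrite (le_trans _ hM')// ler_piMr// cos_max.
by rewrite (le_trans _ hN')// ler_piMr// sin_max.
Qed.

Lemma integrable_norm_normal_pdf s : s != 0 ->
  integrableT (fun x => `|x| * normal_pdf 0 s x).
Proof.
move=> s0; have s20 : 0 < s ^+ 2 by rewrite exprn_even_gt0.
(* The rate [1 / (2 s^2)] is split as [3 / (8 s^2) + 1 / (8 s^2)]: the first part absorbs [|x|], the
   second is the Gaussian of width [2 s]. *)
have c0 : 0 < 3 / (8 * s ^+ 2) by rewrite divr_gt0// mulr_gt0.
have [K [K0 hK]] := norm_le_expR_sqr _ c0.
have s20' : 2 * s != 0 by rewrite mulf_neq0.
have p0 := normal_peak_gt0 s20'.
apply: (@integrable_dominated _ setT _ (fun x =>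
  (normal_peak s * K / normal_peak (2 * s)) * normal_pdf 0 (2 * s) x)) => //.
- apply: measurable_funM; first exact: normr_measurable.
  exact: measurable_normal_pdf.
- move=> x _; rewrite normrM normr_id (ger0_norm (normal_pdf_ge0 _ _ _)).
  rewrite !normal_pdf0_expR// [leRHS]mulrA divfK ?gt_eqF//.
  have -> : - ((2 * s ^+ 2)^-1 * x ^+ 2) = - (3 / (8 * s ^+ 2) * x ^+ 2) -
    (2 * (2 * s) ^+ 2)^-1 * x ^+ 2 by field.
  rewrite expRD expRN; move: (hK x) (expR_gt0 (3 / (8 * s ^+ 2) * x ^+ 2)).
  move: (expR (_ * _)) (expR (- _)) (expR_ge0 (- ((2 * (2 * s) ^+ 2)^-1 * x ^+ 2))).
  move=> u v v0 xu u0; rewrite (_ : `|x| * _ = normal_peak s * (`|x| / u) * v).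
    by rewrite ler_wpM2r// ler_wpM2l ?normal_peak_ge0// ler_pdivrMr.
  by rewrite mulrCA !mulrA.
- by apply: integrable_scale => //; exact: integrable_normal_pdf.
Qed.

Lemma normal_pdf_cvg0 s : s != 0 ->
  normal_pdf 0 s n.+1%:R @[n --> \oo] --> (0 : R).
Proof.
move=> s0.
have c0 : 0 < (2 * s ^+ 2)^-1 by rewrite invr_gt0 mulr_gt0// exprn_even_gt0.
have [M hM] := poly_gauss_bounded _ 'X c0.
have h : (normal_peak s * M * n.+1%:R^-1) @[n --> \oo] --> (0 : R).
  rewrite -(mulr0 (normal_peak s * M)).
  by apply: cvgMr; exact: cvg_harmonic.
apply: (squeeze_cvgr _ (cvg_cst 0) h).
apply: nearW => n; rewrite normal_pdf_ge0/= normal_pdf0_expR// -mulrA.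
rewrite ler_wpM2l ?normal_peak_ge0// ler_pdivlMr// mulrC.
by rewrite (le_trans _ (hM n.+1%:R))// hornerX ler_norm.
Qed.

Lemma normal_pdfN s x : s != 0 -> normal_pdf 0 s (- x) = normal_pdf 0 s x.
Proof. by move=> s0; rewrite !normal_pdf0_expR// sqrrN. Qed.

Lemma is_derive_cos_affine c p x :
  is_derive x 1 (fun y => cos (c * y + p)) (- (c * sin (c * x + p))).
Proof.
have h : is_derive x 1 (fun y : R => c * y + p) (c * 1 + 0).
  by apply: is_derive_add; apply: is_derive_scale.
have := @is_derive1_comp _ (@cos R) (fun y => c * y + p) x _ _
  (is_derive_cos _) h.
by rewrite mulr1 addr0 mulNr mulrC.
Qed.

Lemma is_derive_sin_affine c p x :
  is_derive x 1 (fun y => sin (c * y + p)) (c * cos (c * x + p)).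
Proof.
have h : is_derive x 1 (fun y : R => c * y + p) (c * 1 + 0).
  by apply: is_derive_add; apply: is_derive_scale.
have := @is_derive1_comp _ (@sin R) (fun y => c * y + p) x _ _
  (is_derive_sin _) h.
by rewrite mulr1 addr0 mulrC.
Qed.

Lemma continuous_affine c p : continuous (fun x : R => c * x + p).
Proof. by move=> x; apply: cvgD; [exact: mulrl_continuous|exact: cvg_cst]. Qed.

Lemma continuous_cos_affine c p : continuous (fun x : R => cos (c * x + p)).
Proof.
move=> x; apply: (@continuous_comp _ _ _ (fun x => c * x + p) cos).
  exact: continuous_affine.
exact: continuous_cos.
Qed.

Lemma continuous_sin_affine c p : continuous (fun x : R => sin (c * x + p)).
Proof.
move=> x; apply: (@continuous_comp _ _ _ (fun x => c * x + p) sin).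
  exact: continuous_affine.
exact: continuous_sin.
Qed.

Lemma integrable_normal_pdf_mul s (h : R -> R) : continuous h ->
  (forall x, `|h x| <= 1) -> integrableT (fun x => normal_pdf 0 s x * h x).
Proof.
move=> hc h1; apply: (@integrable_bounded_mul _ setT 1) => //.
  exact: continuous_measurable_fun.
exact: integrable_normal_pdf.
Qed.

(** Integration by parts: a factor [x] on the density is [- s^2] times its derivative. *)
Lemma normal_pdf_sin_moment s t p : s != 0 ->
  \int[mu]_x (x * (normal_pdf 0 s x * sin (t * x + p))) =
  s ^+ 2 * t * \int[mu]_x (normal_pdf 0 s x * cos (t * x + p)).
Proof.
move=> s0.
have cosi : integrableT (fun x => normal_pdf 0 s x * cos (t * x + p)).
  apply: integrable_normal_pdf_mul => [|x]; last exact: cos_max.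
  exact: continuous_cos_affine.
have sini : integrableT (fun x => x * (normal_pdf 0 s x * sin (t * x + p))).
  apply: (integrable_dominated setT _ _ measurableT _ _
    (integrable_norm_normal_pdf _ s0)).
    apply: measurable_funM => //; apply: integrable_measurable.
    apply: integrable_normal_pdf_mul => [|x]; last exact: sin_max.
    exact: continuous_sin_affine.
  move=> x _; rewrite !normrM ler_wpM2l// ger0_norm ?normal_pdf_ge0//.
  by rewrite ler_piMr ?normal_pdf_ge0// sin_max.
pose f x := normal_pdf 0 s x * sin (t * x + p).
pose df x := (- s ^- 2) * (x * (normal_pdf 0 s x * sin (t * x + p))) +
  t * (normal_pdf 0 s x * cos (t * x + p)).
have fdf x : is_derive x 1 f (df x).
  have := is_derive_mul _ _ _ _ _ (is_derive_normal_pdf s x s0)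
    (is_derive_sin_affine t p x).
  by move/is_derive_eq; apply; rewrite /df; ring.
have f_le x : `|f x| <= normal_pdf 0 s x.
  by rewrite normrM ger0_norm ?normal_pdf_ge0// ler_piMr ?normal_pdf_ge0// sin_max.
have : \int[mu]_x df x = 0.
  apply: (@Rintegral_derivative0 _ f) => //.
  - move=> x; apply: cvgD; apply: cvgM; try exact: cvg_cst.
      apply: cvgM; [exact: cvg_id|apply: cvgM].
        exact: continuous_normal_pdf.
      exact: continuous_sin_affine.
    apply: cvgM; first exact: continuous_normal_pdf.
    exact: continuous_cos_affine.
  - by apply: integrable_add => //; exact: integrable_scale.
  - apply/norm_cvg0P; apply: (squeeze_cvgr _ (cvg_cst 0) (normal_pdf_cvg0 _ s0)).
    by apply: nearW => n; rewrite normr_ge0/=.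
  - apply/norm_cvg0P; apply: (squeeze_cvgr _ (cvg_cst 0) (normal_pdf_cvg0 _ s0)).
    by apply: nearW => n; rewrite normr_ge0/= -[leRHS]normal_pdfN.
rewrite /df RintegralD//; [|exact: integrable_scale..].
rewrite !RintegralZl// => /eqP; rewrite mulNr addrC subr_eq0 => /eqP h.
by rewrite -mulrA h mulrA divff ?mul1r// sqrf_eq0.
Qed.

(** As a function of [t] the integral solves [J' = - s^2 t J], so [exp(s^2 t^2 / 2) J] is constant.
    The phase [p] covers the cosine transform ([p = 0]) and the sine transform ([p = - pi / 2]) at
    once. *)
Lemma normal_pdf_cos_transform s t p : s != 0 ->
  \int[mu]_x (normal_pdf 0 s x * cos (t * x + p)) =
  expR (- ((s * t) ^+ 2 / 2)) * cos p.
Proof.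
move=> s0; pose J (t : R) := \int[mu]_x (normal_pdf 0 s x * cos (t * x + p)).
have dJ (u : R) : is_derive u 1 J (- (s ^+ 2 * u) * J u).
  have := @is_derive_Rintegral _
    (fun u x => normal_pdf 0 s x * cos (u * x + p))
    (fun u x => - (x * (normal_pdf 0 s x * sin (u * x + p))))
    (fun x => `|x| * normal_pdf 0 s x) u (integrable_norm_normal_pdf _ s0).
  have -> : \int[mu]_x (- (x * (normal_pdf 0 s x * sin (u * x + p)))) =
      - (s ^+ 2 * u) * J u.
    rewrite mulNr -normal_pdf_sin_moment// -mulN1r -RintegralZl//.
      by apply: eq_Rintegral => x _; rewrite mulN1r.
    apply: (integrable_dominated setT _ _ measurableT _ _
      (integrable_norm_normal_pdf _ s0)).
      apply: measurable_funM => //; apply: integrable_measurable.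
      apply: integrable_normal_pdf_mul => [|x]; last exact: sin_max.
      exact: continuous_sin_affine.
    move=> x _; rewrite !normrM ler_wpM2l// ger0_norm ?normal_pdf_ge0//.
    by rewrite ler_piMr ?normal_pdf_ge0// sin_max.
  apply.
  - move=> v; apply: integrable_normal_pdf_mul => [|x]; last exact: cos_max.
    exact: continuous_cos_affine.
  - move=> v x; have := is_derive_scale (normal_pdf 0 s x) _ _ _
      (is_derive_cos_affine x p v).
    rewrite (_ : (fun u => _) = (fun u => normal_pdf 0 s x * cos (u * x + p))).
      by move/is_derive_eq; apply; rewrite [x * v]mulrC; ring.
    by apply/funext => u0; rewrite [x * u0]mulrC.
  - move=> v x; rewrite normrN !normrM ler_wpM2l// ger0_norm ?normal_pdf_ge0//.
    by rewrite ler_piMr ?normal_pdf_ge0// sin_max.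
pose E (u : R) := expR ((s ^+ 2 / 2) * (u * u)) * J u.
have dE (u : R) : is_derive u 1 E 0.
  have h := is_derive_scale (s ^+ 2 / 2) _ _ _
    (is_derive_mul _ _ _ _ _ (is_derive_id u 1) (is_derive_id u 1)).
  have := is_derive_mul _ _ _ _ _
    (is_derive1_comp (is_derive_expR _) h) (dJ u).
  by move/is_derive_eq; apply => /=; move: (expR _) (J _) => a b; field.
have E0 := is_derive_0_is_cst t 0 dE.
have J0 : J 0 = cos p.
  rewrite /J; under eq_Rintegral do rewrite mul0r add0r.
  rewrite RintegralZr//; last exact: integrable_normal_pdf.
  by rewrite /Rintegral integral_normal_pdf mul1r.
move: E0; rewrite /E !mul0r mulr0 expR0 mul1r J0 => <-.
rewrite mulrA -expRD (_ : _ + _ = 0) ?expR0 ?mul1r//.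
by rewrite exprMn; field.
Qed.

End Gaussian.

(** * Fourier inversion at Lebesgue points *)

Section ApproximateIdentity.
Context {R : realType}.
Local Notation mu := (@lebesgue_measure R).
Local Notation integrableT f := (mu.-integrable [set: R] (EFin \o f)).
Implicit Types (r : R -> R) (x y e s d J M : R).

Lemma integrable_ball_bounded r M x e : measurable_fun [set: R] r ->
  (forall y, `|r y| <= M) ->
  mu.-integrable (ball x e) (EFin \o (fun y => r y - r x)).
Proof.
move=> mr rM; apply: measurable_bounded_integrable.
- exact: measurable_ball.
- have [e0|e0] := ltP e 0.
    by rewrite (ball0 _ _).2 ?ltW// measure0.
  apply: (@le_lt_trans _ _ (e *+ 2)%:E); last exact: ltry.
  by rewrite le_eqVlt; apply/orP; left; apply/eqP; exact: lebesgue_measure_ball.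
- by apply: measurable_funTS; exact: measurable_funB.
- exists (M + M); split; first by rewrite num_real.
  move=> K MK y _ /=; rewrite (le_trans (ler_normB _ _))//.
  by rewrite (le_trans (lerD (rM y) (rM x)))// ltW.
Qed.

Lemma lebesgue_pt_near r M x d : measurable_fun [set: R] r ->
  (forall y, `|r y| <= M) -> lebesgue_pt r x -> 0 < d ->
  \forall e \near (0 : R)^'+,
    \int[mu]_(y in ball x e) `|r y - r x| <= d * (2 * e).
Proof.
move=> mr rM rx d0.
have /fine_cvgP[fin cvg0] := rx.
move/cvgrPdist_le : cvg0 => /(_ _ d0) near_d.
near=> e.
have e0 : 0 < e by near: e; exact: nbhs_right_gt.
have : `|0 - fine (davg r x e)| <= d by near: e.
rewrite sub0r normrN ger0_norm ?fine_ge0 ?davg_ge0//.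
have ri := integrable_ball_bounded r M x e mr rM.
have := @lebesgue_measure_ball R x e (ltW e0). rewrite /davg /iavg => ->.
have finI : (\int[mu]_(y in ball x e) `|(center (r x) \o r) y|%:E)%E \is a fin_num.
  apply: (@integrable_fin_num _ _ _ mu _ _ (EFin \o (fun y => `|r y - r x|))).
    exact: measurable_ball.
  exact: integrable_norm.
rewrite -(fineK finI) inver mulrn_eq0/= gt_eqF//= => h.
rewrite -ler_pdivrMr ?mulr_gt0// mulrC mulr_natl.
exact: h.
Unshelve. all: by end_near. Qed.

Lemma normal_peakE s : 0 < s ->
  normal_peak s = (s * Num.sqrt (pi *+ 2))^-1.
Proof.
by move=> s0; rewrite /normal_peak -mulrnAr sqrtrM ?sqr_ge0// sqrtr_sqr gtr0_norm.
Qed.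

Lemma sqrt_pi2_ge1 : 1 <= Num.sqrt (pi *+ 2 : R).
Proof.
rewrite -[leLHS](@sqrtr1 R) ler_wsqrtr// mulr2n.
by have := @pi_ge2 R; lra.
Qed.

(** Far from [x], the density of width [e] is a small multiple of a density of width [2 e], whose
    total mass is known: this bounds tails without integrating them. *)
Lemma normal_pdf_dilate x e y : 0 < e ->
  normal_pdf x e y = 2 * expR (- (3 / 8 * ((y - x) / e) ^+ 2)) *
                     normal_pdf x (2 * e) y.
Proof.
move=> e0; have e0' := lt0r_neq0 e0; have e20 : 2 * e != 0 by rewrite mulf_neq0.
rewrite !normal_pdf_expR// !normal_peakE ?mulr_gt0//.
have -> : - ((y - x) ^+ 2 / (2 * e ^+ 2)) = - (3 / 8 * ((y - x) / e) ^+ 2) -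
    (y - x) ^+ 2 / (2 * (2 * e) ^+ 2) by field.
have s0 : Num.sqrt (pi *+ 2) != 0 :> R.
  by rewrite gt_eqF// (lt_le_trans ltr01 sqrt_pi2_ge1).
by rewrite expRD; move: (expR _) (expR _) => u v; field; rewrite ?e0' ?s0.
Qed.

Lemma normal_peakM s : 0 < s -> normal_peak s * s <= 1.
Proof.
move=> s0; rewrite normal_peakE// invfM mulrAC mulVf ?gt_eqF// mul1r.
by rewrite invf_le1 ?sqrt_pi2_ge1// (lt_le_trans ltr01 sqrt_pi2_ge1).
Qed.

(** Split at distance [J e] from [x]. Inside, the density is at most its peak. Outside,
    [normal_pdf_dilate] gains the exponential, and [2 * 2 M] is the factor of the dilation times the
    largest possible deviation of [r]. *)
Lemma normal_pdf_mean_deviation r M x J e : measurable_fun [set: R] r ->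
  (forall y, `|r y| <= M) -> 0 < J -> 0 < e ->
  `|\int[mu]_y (r y * normal_pdf x e y) - r x| <=
  normal_peak e * \int[mu]_(y in ball x (J * e)) `|r y - r x| +
  4 * M * expR (- (3 / 8 * J ^+ 2)).
Proof.
move=> mr rM J0 e0; have M0 : 0 <= M by rewrite (le_trans _ (rM x)).
have e00 : e != 0 by rewrite gt_eqF.
have e20 : 2 * e != 0 by rewrite mulf_neq0.
have npi s : integrableT (normal_pdf x s) by exact: integrable_normal_pdf.
have np1 s : \int[mu]_y normal_pdf x s y = 1.
  by rewrite /Rintegral integral_normal_pdf.
have ri : integrableT (fun y => r y * normal_pdf x e y).
  apply: (integrable_ext _ (fun y => normal_pdf x e y * r y)).
    by move=> y; rewrite mulrC.
  exact: (@integrable_bounded_mul _ setT M).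
have di : integrableT (fun y => (r y - r x) * normal_pdf x e y).
  apply: (integrable_ext _
    (fun y => r y * normal_pdf x e y + (- r x) * normal_pdf x e y)).
    by move=> y; rewrite mulrBl mulNr.
  by apply: integrable_add => //; exact: integrable_scale.
have -> : \int[mu]_y (r y * normal_pdf x e y) - r x =
    \int[mu]_y ((r y - r x) * normal_pdf x e y).
  under [RHS]eq_Rintegral do rewrite mulrBl.
  rewrite RintegralB//; last exact: integrable_scale.
  by rewrite RintegralZl// np1 mulr1.
set A := ball x (J * e).
have mA : measurable A by exact: measurable_ball.
have ai : integrableT ((fun y => `|r y - r x|) \_ A).
  have := integrable_ball_bounded r M x (J * e) mr rM => /integrable_norm h.
  have := (@integrable_mkcond _ _ _ mu A _ mA).1 h.
  by rewrite restrict_EFin.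
rewrite (le_trans (le_normr_Rintegral _ _))//.
rewrite [in leRHS]Rintegral_mkcond -RintegralZl//.
have -> : 4 * M * expR (- (3 / 8 * J ^+ 2)) =
    \int[mu]_y (4 * M * expR (- (3 / 8 * J ^+ 2)) * normal_pdf x (2 * e) y).
  by rewrite RintegralZl// np1 mulr1.
rewrite -RintegralD//; [|exact: integrable_scale..].
apply: le_Rintegral => //.
- exact: integrable_norm.
- by apply: integrable_add => //; exact: integrable_scale.
move=> y _; rewrite normrM (ger0_norm (normal_pdf_ge0 _ _ _)).
rewrite patchE; case: ifPn => [_|]; rewrite ?inE.
  rewrite ler_wpDr ?mulr_ge0 ?expR_ge0 ?normal_pdf_ge0//.
  by rewrite mulrC ler_wpM2r// normal_pdf_ub.
rewrite notin_setE /A -ball_normE /ball_/= => /negP; rewrite -leNgt => Jy.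
rewrite mulr0 add0r normal_pdf_dilate// mulrA.
rewrite ler_wpM2r ?normal_pdf_ge0// mulrA ler_pM ?mulr_ge0 ?expR_ge0//.
  rewrite (le_trans (ler_wpM2r _ (ler_normB _ _)))//.
  by have := rM y; have := rM x; lra.
rewrite ler_expR lerN2 ler_wpM2l// -[leRHS]real_normK ?num_real//.
rewrite lerXn2r ?nnegrE ?(ltW J0)//.
by rewrite normrM normfV (gtr0_norm e0) ler_pdivlMr// distrC.
Qed.

Lemma normal_pdf_approximation r M x d : measurable_fun [set: R] r ->
  (forall y, `|r y| <= M) -> lebesgue_pt r x -> 0 < d ->
  \forall e \near (0 : R)^'+,
    `|\int[mu]_y (r y * normal_pdf x e y) - r x| <= d.
Proof.
move=> mr rM rx d0; have M0 : 0 <= M by rewrite (le_trans _ (rM x)).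
(* Large enough for the tail: [exp z >= 1 + z] and [J^2 >= J] reduce the claim to
   [4 M <= (d / 2) (3 / 8) J]. *)
pose J := 1 + 32 * M / d.
have J1 : 1 <= J by rewrite lerDl divr_ge0 ?mulr_ge0// ltW.
have J0 : 0 < J by rewrite (lt_le_trans _ J1).
have tail : 4 * M * expR (- (3 / 8 * J ^+ 2)) <= d / 2.
  rewrite expRN -[_ * _^-1]/(_ / _) ler_pdivrMr ?expR_gt0//.
  apply: (@le_trans _ _ (d / 2 * (3 / 8 * J))).
    have : d / 2 * (3 / 8 * J) = 3 / 16 * d + 6 * M by rewrite /J; field; rewrite gt_eqF.
    by move=> ->; lra.
  rewrite ler_wpM2l ?divr_ge0 ?(ltW d0)//.
  apply: le_trans (expR_ge1Dx _).
  have : J <= J ^+ 2 by rewrite expr2 ler_peMr// ltW.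
  lra.
(* Over a ball of length [2 J e] this accuracy gives [d e / 2], and the peak times [e] is at most
   1. *)
have d4 : 0 < d / (4 * J) by rewrite divr_gt0// mulr_gt0.
have [/= rho rho0 near_d] := lebesgue_pt_near r M x _ mr rM rx d4.
exists (rho / J); first by rewrite /= divr_gt0.
move=> e /= erho e0.
rewrite (le_trans (normal_pdf_mean_deviation r M x J e mr rM J0 e0))//.
rewrite [leRHS](splitr d) lerD// {tail}.
have : \int[mu]_(y in ball x (J * e)) `|r y - r x| <= d / (4 * J) * (2 * (J * e)).
  apply: near_d; last by rewrite mulr_gt0.
  move: erho; rewrite /= !sub0r !normrN normrM (gtr0_norm J0) [J * _]mulrC.
  by rewrite ltr_pdivlMr.
move=> /(ler_wpM2l (normal_peak_ge0 e))/le_trans; apply.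
have -> : normal_peak e * (d / (4 * J) * (2 * (J * e))) =
  normal_peak e * e * (d / 2) by field; rewrite gt_eqF.
by rewrite ler_piMl ?normal_peakM// divr_ge0// ltW.
Qed.

End ApproximateIdentity.

Section Inversion.
Context {R : realType}.
Local Notation mu := (@lebesgue_measure R).
Local Notation integrableT f := (mu.-integrable [set: R] (EFin \o f)).
Implicit Types (r A B : R -> R) (x y s t xi M : R).

(** The real part of [(A - iB) exp(2 i pi xi t)]; [synthesis] is thus a real form of the inverse
    Fourier transform. *)
Definition osc A B t xi : R :=
  A xi * cos (2 * pi * xi * t) + B xi * sin (2 * pi * xi * t).

Definition synthesis A B t : R := \int[mu]_xi osc A B t xi.

(* [r] tested against the Gaussian of width [1 / (2 pi s)] centered at [x]. *)
Definition spectral r A B : Prop := forall x s, 0 < s ->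
  \int[mu]_y (r y * expR (- ((s * (2 * pi * (x - y))) ^+ 2 / 2))) =
  \int[mu]_xi (osc A B x xi * normal_pdf 0 s xi).

Lemma integrable_osc A B t : integrableT A -> integrableT B ->
  integrableT (osc A B t).
Proof.
move=> Ai Bi; apply: integrable_add => //.
  apply: (@integrable_bounded_mul _ setT 1) => // [|x _]; last exact: cos_max.
  apply: continuous_measurable_fun => x.
  under eq_fun do rewrite -[_ * _ * _]mulrA [_ * t]mulrC !mulrA -[_ * _]addr0.
  exact: continuous_cos_affine.
apply: (@integrable_bounded_mul _ setT 1) => // [|x _]; last exact: sin_max.
apply: continuous_measurable_fun => x.
under eq_fun do rewrite -[_ * _ * _]mulrA [_ * t]mulrC !mulrA -[_ * _]addr0.
exact: continuous_sin_affine.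
Qed.

Lemma osc_le A B t xi : `|osc A B t xi| <= `|A xi| + `|B xi|.
Proof.
rewrite (le_trans (ler_normD _ _))// lerD// normrM ler_piMr//.
  exact: cos_max.
exact: sin_max.
Qed.

Lemma gauss_kernel_normal_pdf x y s : 0 < s ->
  expR (- ((s * (2 * pi * (x - y))) ^+ 2 / 2)) =
  normal_pdf x (2 * pi * s)^-1 y / normal_peak (2 * pi * s)^-1.
Proof.
move=> s0; have ps0 : 0 < 2 * pi * s by rewrite !mulr_gt0// pi_gt0.
rewrite normal_pdf_expR ?invr_neq0 ?gt_eqF// [_ * expR _]mulrC mulfK.
  congr expR; move: (pi : R) (@pi_gt0 R) => p p0.
  by field; rewrite (lt0r_neq0 s0) (lt0r_neq0 p0).
by rewrite gt_eqF// normal_peak_gt0// invr_neq0// gt_eqF.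
Qed.

(** A Gaussian of width [s] and its transform, of width [1 / (2 pi s)], have reciprocal peaks. Hence
    normalizing one side of [spectral] to a probability density turns the other side into a factor
    equal to 1 at frequency 0. *)
Lemma normal_peak_dual s : 0 < s ->
  normal_peak (2 * pi * s)^-1 * normal_peak s = 1.
Proof.
move=> s0; have p0 := @pi_gt0 R; have ps0 : 0 < 2 * pi * s by rewrite !mulr_gt0.
rewrite !normal_peakE ?invr_gt0// -invfM.
have -> : (2 * pi * s)^-1 * Num.sqrt (pi *+ 2) * (s * Num.sqrt (pi *+ 2)) =
    (2 * pi * s)^-1 * s * (Num.sqrt (pi *+ 2)) ^+ 2 by ring.
have pi2 : 0 <= pi *+ 2 :> R by rewrite mulrn_wge0// ltW.
rewrite (sqr_sqrtr pi2) mulr2n.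
rewrite (_ : _ * _ = 1) ?invr1//; move: (pi : R) p0 {ps0} => p p0.
by field; rewrite (lt0r_neq0 s0) (lt0r_neq0 p0).
Qed.

(** Take [s = n + 1] in [spectral] and let [n] grow. In time the Gaussians concentrate at the
    Lebesgue point [x] and give [r x]; in frequency the factor increases to 1 and dominated
    convergence gives [synthesis A B x]. *)
Lemma spectral_inversion r A B M x : measurable_fun [set: R] r ->
  (forall y, `|r y| <= M) -> integrableT A -> integrableT B ->
  spectral r A B -> lebesgue_pt r x -> r x = synthesis A B x.
Proof.
move=> mr rM Ai Bi rAB rx; have p0 := @pi_gt0 R.
pose s n : R := n.+1%:R.
have s0 n : 0 < s n by rewrite ltr0n.
pose e n : R := (2 * pi * s n)^-1.
have e0 n : 0 < e n by rewrite invr_gt0 !mulr_gt0.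
have ecvg : e n @[n --> \oo] --> (0 : R).
  rewrite (_ : e = fun n => (2 * pi)^-1 * n.+1%:R^-1); last first.
    by apply/funext => n; rewrite /e invfM.
  by rewrite -(mulr0 (2 * pi)^-1); apply: cvgMr; exact: cvg_harmonic.
have lhs : (\int[mu]_y (r y * normal_pdf x (e n) y)) @[n --> \oo] --> r x.
  apply/cvgrPdist_le => d d0.
  have [/= rho rho0 near_d] := normal_pdf_approximation r M x d mr rM rx d0.
  have [N _ hN] := (cvgrPdist_lt _ _).1 ecvg _ rho0.
  by exists N => // n Nn; rewrite /= distrC; apply: near_d => //; exact: hN.
have rhs : (\int[mu]_xi (osc A B x xi *
    expR (- ((2 * s n ^+ 2)^-1 * xi ^+ 2)))) @[n --> \oo] --> synthesis A B x.
  have osci := integrable_osc A B x Ai Bi.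
  apply: (@Rintegral_dominated_cvg _ setT _ _ (fun xi => `|osc A B x xi|)) => //.
  - move=> n; apply: measurable_funM; first exact: integrable_measurable.
    apply: measurableT_comp => //; apply: measurableT_comp => //.
    by apply: measurable_funM => //; exact: measurable_funX.
  - exact: integrable_measurable.
  - move=> xi _; rewrite -[X in _ --> X]mulr1; apply: cvgM; first exact: cvg_cst.
    rewrite -[X in _ --> X]expR0; apply: (@cvg_comp _ _ _ _ expR);
      last exact: continuous_expR.
    have h : (s n)^-1 @[n --> \oo] --> (0 : R) by exact: cvg_harmonic.
    have h2 : (s n)^-1 * (s n)^-1 @[n --> \oo] --> (0 * 0 : R) by exact: cvgM.
    have h3 : 2^-1 * ((s n)^-1 * (s n)^-1) @[n --> \oo] --> (2^-1 * (0 * 0) : R).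
      by apply: cvgM => //; exact: cvg_cst.
    have h4 : - (2^-1 * ((s n)^-1 * (s n)^-1) * xi ^+ 2) @[n --> \oo] -->
        (- (2^-1 * (0 * 0) * xi ^+ 2) : R).
      by apply: cvgN; apply: cvgM => //; exact: cvg_cst.
    move: h4; rewrite !mulr0 mul0r oppr0; apply: cvg_trans; apply: near_eq_cvg.
    apply: nearW => n; congr (- (_ * _)).
    by rewrite invfM [s n ^+ 2]expr2 invfM.
  - move=> n xi _; rewrite normrM ler_piMr// ger0_norm ?expR_ge0//.
    suff: expR (- ((2 * s n ^+ 2)^-1 * xi ^+ 2)) <= expR 0 by rewrite expR0.
    rewrite ler_expR oppr_le0.
    by rewrite mulr_ge0 ?sqr_ge0// invr_ge0 mulr_ge0 ?sqr_ge0.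
  - exact: integrable_norm.
suff E n : \int[mu]_y (r y * normal_pdf x (e n) y) =
    \int[mu]_xi (osc A B x xi * expR (- ((2 * s n ^+ 2)^-1 * xi ^+ 2))).
  by move: lhs; under eq_fun do rewrite E; move=> lhs; exact: (cvg_unique _ lhs rhs).
have pk : normal_peak (e n) != 0 by rewrite gt_eqF// normal_peak_gt0// gt_eqF.
have oi : integrableT (fun xi => osc A B x xi * normal_pdf 0 (s n) xi).
  apply: (@integrable_bounded_mul _ setT (normal_peak (s n))) => //.
  - exact: measurable_normal_pdf.
  - move=> y _; rewrite ger0_norm ?normal_pdf_ge0//.
    by apply: normal_pdf_ub; rewrite gt_eqF.
  - exact: integrable_osc.
have -> : \int[mu]_xi (osc A B x xi * expR (- ((2 * s n ^+ 2)^-1 * xi ^+ 2))) =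
    normal_peak (e n) * \int[mu]_xi (osc A B x xi * normal_pdf 0 (s n) xi).
  rewrite -RintegralZl//; apply: eq_Rintegral => xi _.
  rewrite normal_pdf0_expR ?gt_eqF// [RHS]mulrCA; congr (_ * _).
  have pd : normal_peak (e n) * normal_peak (s n) = 1 by exact: normal_peak_dual.
  by rewrite [RHS]mulrA pd mul1r.
rewrite -rAB// -RintegralZl//.
  apply: eq_Rintegral => y _; rewrite gauss_kernel_normal_pdf// [RHS]mulrCA.
  by rewrite -/(e n); congr (_ * _); rewrite mulrC divfK.
apply: (integrable_ext _ (fun y => (normal_peak (e n))^-1 *
    (normal_pdf x (e n) y * r y))).
  by move=> y; rewrite gauss_kernel_normal_pdf// -/(e n); ring.
apply: integrable_scale => //; apply: (@integrable_bounded_mul _ setT M) => //.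
exact: integrable_normal_pdf.
Qed.

Lemma bounded_lebesgue_pt r M : measurable_fun [set: R] r ->
  (forall y, `|r y| <= M) -> {ae mu, forall x, lebesgue_pt r x}.
Proof.
move=> mr rM; apply: lebesgue_differentiation; split => //; first exact: openT.
move=> K _ Kc.
have mK := compact_measurable Kc.
have : mu.-integrable K (EFin \o r).
  apply: measurable_bounded_integrable => //.
  - exact: compact_finite_measure.
  - exact: measurable_funTS.
  - exists M; split; first by rewrite num_real.
    by move=> N MN y _ /=; rewrite (le_trans (rM y))// ltW.
by move=> /integrableP[].
Qed.

End Inversion.

(** * The leaky integral in frequency *)

Section SpectralOfFourier.
Context {R : realType}.
Local Notation mu := (@lebesgue_measure R).
Implicit Types (f g : R -> R[i]) (x y s : R).

Lemma gauss_wave10 c s x : gauss_wave c s 1 0 x = cos (c * x) * normal_pdf 0 s x.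
Proof. by rewrite /gauss_wave horner0 -polyC1 hornerC mul1r mul0r addr0. Qed.

Lemma gauss_wave01 c s x : gauss_wave c s 0 1 x = sin (c * x) * normal_pdf 0 s x.
Proof. by rewrite /gauss_wave horner0 -polyC1 hornerC mul1r mul0r add0r. Qed.

(** The Gaussian density modulated by [exp(2 i pi x xi)], whose transform is a real Gaussian
    centered at [x]. The distributional identity is tested on these functions alone. *)
Definition gauss_test x s (xi : R) : R[i] := Complex
  (gauss_wave (2 * pi * x) s 1 0 xi) (gauss_wave (2 * pi * x) s 0 1 xi).

Lemma fourier_gauss_test x s y : s != 0 -> fourier (gauss_test x s) y =
  Complex (expR (- ((s * (2 * pi * (x - y))) ^+ 2 / 2))) 0.
Proof.
move=> s0; rewrite /fourier /cintegral; congr Complex.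
  have := normal_pdf_cos_transform s (2 * pi * (x - y)) 0 s0.
  rewrite cos0 mulr1 => <-.
  apply: eq_Rintegral => xi _; rewrite /gauss_test/= gauss_wave10 gauss_wave01.
  rewrite addr0 cosN sinN.
  have -> : 2 * pi * (x - y) * xi = 2 * pi * x * xi - 2 * pi * y * xi by ring.
  by rewrite cosB; ring.
have := normal_pdf_cos_transform s (2 * pi * (x - y)) (- (pi / 2)) s0.
rewrite cosN cos_pihalf mulr0 => <-.
apply: eq_Rintegral => xi _; rewrite /gauss_test/= gauss_wave10 gauss_wave01.
rewrite cosBpihalf cosN sinN.
have -> : 2 * pi * (x - y) * xi = 2 * pi * x * xi - 2 * pi * y * xi by ring.
by rewrite sinB; ring.
Qed.

Lemma spectral_of_fourier f g : integrable_fourier_transform f g ->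
  spectral (fun x => complex.Re (f x)) (fun xi => complex.Re (g xi))
           (fun xi => - complex.Im (g xi)) /\
  spectral (fun x => complex.Im (f x)) (fun xi => complex.Im (g xi))
           (fun xi => complex.Re (g xi)).
Proof.
move=> [_ fg].
have key x s : 0 < s -> cintegral setT (fun y => f y * Complex
      (expR (- ((s * (2 * pi * (x - y))) ^+ 2 / 2))) 0) =
    cintegral setT (fun xi => g xi * gauss_test x s xi).
  move=> s0; rewrite -fg.
    by congr cintegral; apply/funext => y; rewrite fourier_gauss_test// gt_eqF.
  by split; apply: real_schwartz_gauss_wave; rewrite gt_eqF.
split=> x s s0; have [kRe kIm] := key x s s0.
  transitivity (\int[mu]_y complex.Re (f y *
      Complex (expR (- ((s * (2 * pi * (x - y))) ^+ 2 / 2))) 0)).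
    by apply: eq_Rintegral => y _; case: (f y) => a b /=; rewrite mulr0 subr0.
  rewrite kRe; apply: eq_Rintegral => xi _.
  case gE : (g xi) => [a b] /=; rewrite gauss_wave10 gauss_wave01 /osc gE/=.
  have -> : 2 * pi * xi * x = 2 * pi * x * xi by ring.
  ring.
transitivity (\int[mu]_y complex.Im (f y *
    Complex (expR (- ((s * (2 * pi * (x - y))) ^+ 2 / 2))) 0)).
  by apply: eq_Rintegral => y _; case: (f y) => a b /=; rewrite mulr0 add0r.
rewrite kIm; apply: eq_Rintegral => xi _.
case gE : (g xi) => [a b] /=; rewrite gauss_wave10 gauss_wave01 /osc gE/=.
have -> : 2 * pi * xi * x = 2 * pi * x * xi by ring.
ring.
Qed.

End SpectralOfFourier.

(** * The exponential filter on the frequency side *)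

Section Leak.
Context {R : realType}.
Local Notation mu := (@lebesgue_measure R).
Local Notation integrableT f := (mu.-integrable [set: R] (EFin \o f)).
Variables (alpha : R) (A B : R -> R).
Hypotheses (alpha0 : 0 < alpha) (Ai : integrableT A) (Bi : integrableT B).
Implicit Types (r : R -> R) (s t x xi : R).

(* [(A - iB) / (alpha + 2 i pi xi) = leak_cos - i leak_sin] *)
Definition leak_cos xi : R :=
  (alpha * A xi - 2 * pi * xi * B xi) / (alpha ^+ 2 + (2 * pi * xi) ^+ 2).
Definition leak_sin xi : R :=
  (2 * pi * xi * A xi + alpha * B xi) / (alpha ^+ 2 + (2 * pi * xi) ^+ 2).

(** The bounded solution [u] of [u' + alpha u = synthesis A B], obtained by dividing by the symbol
    [alpha + 2 i pi xi]. *)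
Definition leak t : R := synthesis leak_cos leak_sin t.

Let den_gt0 w : 0 < alpha ^+ 2 + w ^+ 2.
Proof. by rewrite ltr_wpDr ?sqr_ge0// exprn_gt0. Qed.

Let omega_measurable : measurable_fun [set: R] (fun xi : R => 2 * pi * xi).
Proof. exact: measurable_funM. Qed.

Let invden_measurable :
  measurable_fun [set: R] (fun xi : R => (alpha ^+ 2 + (2 * pi * xi) ^+ 2)^-1).
Proof.
apply: continuous_measurable_fun => x; apply: cvgV.
  by rewrite gt_eqF.
apply: cvgD; first exact: cvg_cst.
apply: (@continuous_comp _ _ _ (fun x : R => 2 * pi * x) (fun y => y ^+ 2)).
  exact: mulrl_continuous.
exact: sqr_continuous.
Qed.

Let A_measurable := integrable_measurable setT A Ai.
Let B_measurable := integrable_measurable setT B Bi.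

Lemma leak_coef_bound (w a b : R) :
  `|(alpha * a + w * b) / (alpha ^+ 2 + w ^+ 2)| <= alpha^-1 * (`|a| + `|b|).
Proof.
have d0 := den_gt0 w.
rewrite normrM normfV (gtr0_norm d0) ler_pdivrMr//.
have -> : alpha^-1 * (`|a| + `|b|) * (alpha ^+ 2 + w ^+ 2) =
    (alpha + alpha^-1 * w ^+ 2) * (`|a| + `|b|) by field; rewrite gt_eqF.
have wl : `|w| <= alpha + alpha^-1 * w ^+ 2.
  rewrite -(ler_pM2l alpha0) mulrDr mulrA divff ?gt_eqF// mul1r -expr2.
  rewrite -[w ^+ 2]real_normK ?num_real//.
  have := sqr_ge0 (alpha - `|w|); rewrite sqrrB.
  have : 0 <= alpha * `|w| by rewrite mulr_ge0// ltW.
  lra.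
have al : alpha <= alpha + alpha^-1 * w ^+ 2.
  by rewrite lerDl mulr_ge0 ?sqr_ge0// invr_ge0 ltW.
rewrite (le_trans (ler_normD _ _))// !normrM (gtr0_norm alpha0) mulrDr.
by rewrite lerD// ler_wpM2r.
Qed.

(** Division by [alpha + i w] absorbs one factor [w] with a constant independent of [alpha]. This
    permits differentiation under the integral, and later the treatment of frequencies above
    [Omega]. *)
Lemma leak_coef_bound1 (w a b : R) :
  `|w * ((alpha * a + w * b) / (alpha ^+ 2 + w ^+ 2))| <= `|a| + `|b|.
Proof.
have d0 := den_gt0 w.
rewrite mulrA normrM normfV (gtr0_norm d0) ler_pdivrMr//.
have wl : alpha * `|w| <= alpha ^+ 2 + w ^+ 2.
  rewrite -[w ^+ 2]real_normK ?num_real//.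
  have := sqr_ge0 (alpha - `|w|); rewrite sqrrB.
  have : 0 <= alpha * `|w| by rewrite mulr_ge0// ltW.
  lra.
have al : `|w| * `|w| <= alpha ^+ 2 + w ^+ 2.
  by rewrite -expr2 real_normK ?num_real// lerDr sqr_ge0.
rewrite mulrDr (le_trans (ler_normD _ _))// !normrM (gtr0_norm alpha0) mulrDl.
rewrite lerD// mulrA [leRHS]mulrC ler_wpM2r//.
by rewrite mulrC.
Qed.

Lemma leak_cos_le xi : `|leak_cos xi| <= alpha^-1 * (`|A xi| + `|B xi|).
Proof.
rewrite /leak_cos; have := leak_coef_bound (2 * pi * xi) (A xi) (- B xi).
by rewrite normrN mulrN.
Qed.

Lemma leak_sin_le xi : `|leak_sin xi| <= alpha^-1 * (`|A xi| + `|B xi|).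
Proof.
rewrite /leak_sin; have := leak_coef_bound (2 * pi * xi) (B xi) (A xi).
by rewrite [alpha * _ + _]addrC [`|B xi| + _]addrC.
Qed.

Lemma omega_leak_cos_le xi : `|2 * pi * xi * leak_cos xi| <= `|A xi| + `|B xi|.
Proof.
rewrite /leak_cos; have := leak_coef_bound1 (2 * pi * xi) (A xi) (- B xi).
by rewrite normrN mulrN.
Qed.

Lemma omega_leak_sin_le xi : `|2 * pi * xi * leak_sin xi| <= `|A xi| + `|B xi|.
Proof.
rewrite /leak_sin; have := leak_coef_bound1 (2 * pi * xi) (B xi) (A xi).
by rewrite [alpha * _ + _]addrC [`|B xi| + _]addrC.
Qed.

Lemma integrable_norm_add : integrableT (fun xi => `|A xi| + `|B xi|).
Proof. by apply: integrable_add => //; exact: integrable_norm. Qed.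

Lemma integrable_leak_cos : integrableT leak_cos.
Proof.
apply: (integrable_dominated _ _ _ measurableT _ (fun x _ => leak_cos_le x)).
  apply: measurable_funM => //; apply: measurable_funB.
    exact: measurable_funM.
  exact: measurable_funM.
by apply: integrable_scale => //; exact: integrable_norm_add.
Qed.

Lemma integrable_leak_sin : integrableT leak_sin.
Proof.
apply: (integrable_dominated _ _ _ measurableT _ (fun x _ => leak_sin_le x)).
  apply: measurable_funM => //; apply: measurable_funD.
    exact: measurable_funM.
  exact: measurable_funM.
by apply: integrable_scale => //; exact: integrable_norm_add.
Qed.

Lemma is_derive_leak t : is_derive t 1 leak (synthesis A B t - alpha * leak t).
Proof.
pose dosc s xi := 2 * pi * xi * leak_sin xi * cos (2 * pi * xi * s) -
  2 * pi * xi * leak_cos xi * sin (2 * pi * xi * s).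
have Gi : integrableT (fun xi => 2 * (`|A xi| + `|B xi|)).
  by apply: integrable_scale => //; exact: integrable_norm_add.
have osci s := integrable_osc leak_cos leak_sin s integrable_leak_cos
  integrable_leak_sin.
have -> : synthesis A B t - alpha * leak t = \int[mu]_xi dosc t xi.
  rewrite /leak /synthesis -RintegralZl// -RintegralB//; last 2 first.
  - exact: integrable_osc.
  - exact: integrable_scale.
  apply: eq_Rintegral => xi _.
  rewrite /osc /dosc /leak_cos /leak_sin.
  move: (2 * pi * xi) (den_gt0 (2 * pi * xi)) => w /lt0r_neq0 d0.
  by field.
apply: (@is_derive_Rintegral _ (osc leak_cos leak_sin) dosc _ _ Gi osci).
  move=> s xi; have := is_derive_add _ _ _ _ _
    (is_derive_scale (leak_cos xi) _ _ _ (is_derive_cos_scale (2 * pi * xi) s))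
    (is_derive_scale (leak_sin xi) _ _ _ (is_derive_sin_scale (2 * pi * xi) s)).
  by move/is_derive_eq; apply; rewrite /dosc; ring.
move=> s xi; rewrite (le_trans (ler_normB _ _))// [leRHS]mulr_natl mulr2n.
rewrite lerD// normrM.
  by rewrite (le_trans _ (omega_leak_sin_le xi))// ler_piMr// cos_max.
by rewrite (le_trans _ (omega_leak_cos_le xi))// ler_piMr// sin_max.
Qed.

Lemma leak_le t : `|leak t| <=
  \int[mu]_xi (2 * (alpha^-1 * (`|A xi| + `|B xi|))).
Proof.
have osci := integrable_osc leak_cos leak_sin t integrable_leak_cos
  integrable_leak_sin.
rewrite (le_trans (le_normr_Rintegral _ _))// le_Rintegral//.
- exact: integrable_norm.
- do 2 (apply: integrable_scale => //); exact: integrable_norm_add.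
move=> xi _; rewrite (le_trans (osc_le _ _ _ _))//.
have := leak_cos_le xi; have := leak_sin_le xi; lra.
Qed.

Lemma continuous_synthesis : continuous (synthesis A B).
Proof.
move=> t.
apply: (@continuity_under_integral _ _ _ mu (osc A B) setT measurableT
  (t - 1) (t + 1) _ _ (fun xi => `|A xi| + `|B xi|)).
- by move=> s _; exact: integrable_osc.
- apply: aeW => xi _ s _; apply: cvgD; apply: cvgM; try exact: cvg_cst.
    have := continuous_cos_affine (2 * pi * xi) 0 s.
    by under eq_fun do rewrite addr0.
  have := continuous_sin_affine (2 * pi * xi) 0 s.
  by under eq_fun do rewrite addr0.
- exact: integrable_norm_add.
- by move=> s _; apply: aeW => xi _; exact: osc_le.
- by rewrite inE/= in_itv/=; lra.
Qed.

End Leak.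

(** * The exponential filter in time, and its agreement with the frequency side *)

Section LeakyAverage.
Context {R : realType}.
Local Notation mu := (@lebesgue_measure R).
Local Notation integrableT f := (mu.-integrable [set: R] (EFin \o f)).
Variables (alpha : R).
Hypothesis alpha0 : 0 < alpha.
Implicit Types (r : R -> R) (s t x : R).

Let weight t x : R := expR (alpha * (x - t)).

Let weight_continuous t : continuous (weight t).
Proof.
move=> x; apply: (@continuous_comp _ _ _ (fun x => alpha * (x - t)) expR).
  apply: cvgM; first exact: cvg_cst.
  by apply: cvgB; [exact: cvg_id|exact: cvg_cst].
exact: continuous_expR.
Qed.

Let weight_measurable t : measurable_fun [set: R] (weight t).
Proof. by apply: continuous_measurable_fun; exact: weight_continuous. Qed.

Let weight_shift s t x : weight t x = expR (- (alpha * (t - s))) * weight s x.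
Proof. by rewrite /weight -expRD; congr expR; ring. Qed.

Let dweight1 t x : is_derive x 1 (weight t) (alpha * weight t x).
Proof.
have h : is_derive x 1 (fun y => alpha * (y + (- t))) (alpha * (1 + 0)).
  by apply: is_derive_scale; apply: is_derive_add.
have := @is_derive1_comp _ expR (fun y => alpha * (y - t)) x _ _
  (is_derive_expR _) h.
by move/is_derive_eq; apply; rewrite addr0 mulr1 mulrC.
Qed.

Let dweight t x :
  is_derive x 1 (fun y => weight t (- y)) (- (alpha * weight t (- x))).
Proof.
have := @is_derive1_comp _ (weight t) -%R x _ _ (dweight1 t (- x))
  (is_deriveNid x 1).
by move/is_derive_eq; apply; rewrite mulrN1.
Qed.

Let integral_weight t :
  (\int[mu]_(x in `]-oo, t]) (weight t x)%:E = (alpha^-1)%:E)%E.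
Proof.
have /= := @ge0_integration_by_substitutionNy R (weight t) (- t).
rewrite opprK => -> //.
- rewrite (@ge0_continuous_FTC2y _ _ (fun x => - alpha^-1 * weight t (- x)) _ 0).
  + by rewrite opprK /weight subrr mulr0 expR0 mulr1 EFinN oppeK add0e.
  + by move=> x _; exact: expR_ge0.
  + apply: continuous_subspaceT => x.
    apply: (@continuous_comp _ _ _ -%R (weight t)); first exact: opp_continuous.
    exact: weight_continuous.
  + rewrite -(mulr0 (- alpha^-1)); apply: cvgM; first exact: cvg_cst.
    rewrite (_ : (fun x => _) = (fun z => expR (- z)) \o
      (fun x => alpha * (x + t))); last first.
      by apply/funext => x; rewrite /weight /=; congr expR; ring.
    apply: (@cvg_comp _ _ _ _ _ _ (pinfty_nbhs R)); last exact: cvgr_expR.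
    by apply: gt0_cvgMry => //; exact: cvg_addrr.
  + move=> x _.
    by have [] := is_derive_scale (- alpha^-1) _ _ _ (dweight t x).
  + apply: cvg_at_right_filter; apply: cvgM; first exact: cvg_cst.
    apply: (@continuous_comp _ _ _ -%R (weight t)); first exact: opp_continuous.
    exact: weight_continuous.
  + move=> x _; rewrite derive1E.
    have [_ ->] := is_derive_scale (- alpha^-1) _ _ _ (dweight t x).
    by rewrite mulNr mulrN opprK mulKf ?gt_eqF.
- by apply: continuous_subspaceT; exact: weight_continuous.
- by move=> x _; exact: expR_ge0.
Qed.

Definition leaky_past r t : R :=
  \int[mu]_(x in `]-oo, t]) (r x * expR (alpha * (x - t))).
Definition leaky_window r s t : R :=
  \int[mu]_(x in `[s, t]) (r x * expR (alpha * (x - t))).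

Let integrable_weight t : mu.-integrable `]-oo, t] (EFin \o weight t).
Proof.
apply/integrableP; split.
  by apply/measurable_EFinP; apply: measurable_funTS; exact: weight_measurable.
under eq_integral do rewrite /= ger0_norm ?expR_ge0//.
by rewrite integral_weight ltry.
Qed.

Section Bounded.
Variables (r : R -> R) (M : R).
Hypotheses (mr : measurable_fun [set: R] r) (rM : forall x, `|r x| <= M).

Let integrable_past t :
  mu.-integrable `]-oo, t] (EFin \o (fun x => r x * weight t x)).
Proof.
apply: (integrable_ext _ (fun x => weight t x * r x)).
  by move=> x; rewrite mulrC.
apply: (@integrable_bounded_mul _ _ M) => //.
exact: measurable_funTS.
Qed.

Lemma leaky_past_le t : `|leaky_past r t| <= M / alpha.
Proof.
have -> : M / alpha = \int[mu]_(x in `]-oo, t]) (M * weight t x).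
  by rewrite RintegralZl// /Rintegral integral_weight.
rewrite (le_trans (le_normr_Rintegral _ (integrable_past t)))//.
apply: le_Rintegral => //.
- exact: integrable_norm.
- exact: integrable_scale.
by move=> x _; rewrite normrM (ger0_norm (expR_ge0 _)) ler_wpM2r ?expR_ge0.
Qed.

Lemma leaky_past_split s t : s <= t ->
  leaky_past r t = expR (- (alpha * (t - s))) * leaky_past r s +
                   leaky_window r s t.
Proof.
move=> st; apply/eqP; rewrite addrC -subr_eq; apply/eqP.
have -> : leaky_window r s t =
    \int[mu]_(x in `]s, t]) (r x * expR (alpha * (x - t))).
  rewrite /leaky_window -Rintegral_itv_obnd_cbnd//.
  apply: integrableS (integrable_past t) => //.
  by apply: subset_itvr; rewrite bnd_simp.
rewrite -(@Rintegral_itvB _ _ -oo%O (BRight t) s (integrable_past t))//.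
congr (_ - _); rewrite -RintegralZl//.
by apply: eq_Rintegral => x _; rewrite -/(weight t x) (weight_shift s) mulrCA.
Qed.

Section Spectral.
Variables (A B : R -> R).
Hypotheses (Ai : integrableT A) (Bi : integrableT B).
Hypothesis rE : {ae mu, forall x, r x = synthesis A B x}.

Let V := leak alpha A B.

(** Integrating factor: [V * weight t] has derivative [synthesis A B * weight t], and an almost
    everywhere identity for [r] suffices under the integral. *)
Lemma leaky_window_leak s t : s <= t ->
  leaky_window r s t = V t - expR (- (alpha * (t - s))) * V s.
Proof.
rewrite le_eqVlt => /predU1P[<-|st].
  rewrite /leaky_window set_itv1 Rintegral_set1 subrr mulr0 oppr0 expR0 mul1r.
  by rewrite subrr.
have synth_c := continuous_synthesis _ _ Ai Bi.
have prod_c : continuous (fun x => synthesis A B x * weight t x).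
  by move=> x; apply: cvgM; [exact: synth_c|exact: weight_continuous].
have prod_m := continuous_measurable_fun prod_c.
have -> : leaky_window r s t =
    \int[mu]_(x in `[s, t]) (synthesis A B x * weight t x).
  congr fine; apply: ae_eq_integral => //.
  - apply: measurable_funTS; apply/measurable_EFinP; apply: measurable_funM => //.
    exact: weight_measurable.
  - apply: measurable_funTS; apply/measurable_EFinP.
    exact: prod_m.
  - apply: negligibleS rE => x /=; apply: contra_not => rx _.
    by congr (_%:E); rewrite rx.
have dV x : is_derive x 1 (fun x => V x * weight t x)
    (synthesis A B x * weight t x).
  have := is_derive_mul _ _ _ _ _
    (is_derive_leak _ _ _ alpha0 Ai Bi x) (dweight1 t x).
  by move/is_derive_eq; apply; rewrite /V; ring.
rewrite (Rintegral_derivative _ _ _ _ st prod_c dV).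
rewrite /weight subrr mulr0 expR0 mulr1; congr (_ - _); rewrite mulrC.
by congr (expR _ * _); ring.
Qed.

(** Both sides obey the same recursion over windows, so their difference at [t] is
    [exp(- alpha (t - s))] times that at [s]. Both are bounded, and [s] is arbitrarily far in the
    past. *)
Lemma leaky_past_leak t : leaky_past r t = V t.
Proof.
pose K := M / alpha + \int[mu]_xi (2 * (alpha^-1 * (`|A xi| + `|B xi|))).
have bound s : s <= t ->
    `|leaky_past r t - V t| <= expR (- (alpha * (t - s))) * K.
  move=> st; rewrite (leaky_past_split s)// leaky_window_leak//.
  have -> (a b c : R) : a * b + (V t - a * c) - V t = a * (b - c) by ring.
  rewrite normrM (ger0_norm (expR_ge0 _)) ler_wpM2l ?expR_ge0//.
  rewrite (le_trans (ler_normB _ _))// lerD ?leaky_past_le//.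
  exact: leak_le.
have K0 : 0 <= K.
  rewrite addr_ge0 ?divr_ge0 ?(ltW alpha0)//; first by rewrite (le_trans _ (rM 0)).
  by apply: Rintegral_ge0 => x _; rewrite !mulr_ge0 ?invr_ge0 ?(ltW alpha0) ?addr_ge0.
apply/eqP; rewrite -subr_eq0 -normr_le0; apply/ler_addgt0Pr => e e0.
(* Chosen so that [exp(- z) K <= e], from [exp z >= z]; the starting time is then
   [t - z / alpha]. *)
rewrite add0r; pose z := K / e.
have z0 : 0 <= z by rewrite divr_ge0// ltW.
have st : t - z / alpha <= t by rewrite gerBl divr_ge0// ltW.
rewrite (le_trans (bound _ st))//.
have -> : alpha * (t - (t - z / alpha)) = z by field; rewrite gt_eqF.
rewrite expRN mulrC ler_pdivrMr ?expR_gt0//.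
apply: (@le_trans _ _ (e * z)); first by rewrite mulrC divfK// gt_eqF.
rewrite ler_wpM2l ?(ltW e0)// (le_trans _ (expR_ge1Dx _))//; lra.
Qed.

Lemma continuous_leak : continuous V.
Proof.
move=> x; apply/differentiable_continuous/derivable1_diffP/ex_derive.
exact: is_derive_leak.
Qed.

End Spectral.
End Bounded.
End LeakyAverage.

(** * Spike trains *)

Section Train.
Context {R : realType}.
Implicit Types (alpha theta T DC t : R) (u : R -> R) (tau q : nat -> R).

(* What the sampler reveals about one real component [u] of the leaky average
   of the signal over the whole past. *)
Record lif_train alpha theta T DC n u tau q : Prop := LifTrain {
  train_start : tau 0%N = 0;
  train_mono : forall k, (k < n)%N -> tau k <= tau k.+1;
  train_jump : forall k, (k < n)%N -> u (tau k.+1) =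
    expR (- (alpha * (tau k.+1 - tau k))) * u (tau k) + theta * q k;
  train_silent : forall k t, (k <= n)%N -> tau k <= t <= T ->
    ((k < n)%N -> t <= tau k.+1) ->
    `|u t - expR (- (alpha * (t - tau k))) * u (tau k)| <= theta;
  train_future : forall t, tau n < t ->
    `|u t - expR (- (alpha * (t - tau n))) * u (tau n)| <= DC;
  train_past : forall t, t <= 0 -> `|u t| <= DC }.

(** Response at time [t] of the exponential filter to impulses [q j] at the times [tau j.+1]; the
    boolean multiplicity switches off impulses that are still to come. *)
Definition train_sum alpha n tau q t : R :=
  \sum_(0 <= j < n) q j * (expR (- (alpha * (t - tau j.+1))) *+ (tau j.+1 <= t)%R).

Section OneTrain.
Variables (alpha theta T DC : R) (n : nat) (u : R -> R) (tau q : nat -> R).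
Hypothesis uT : lif_train alpha theta T DC n u tau q.

Lemma train_le k l : (k <= l <= n)%N -> tau k <= tau l.
Proof.
elim: l => [|l ih] /andP[kl ln]; first by move: kl; rewrite leqn0 => /eqP ->.
move: kl; rewrite leq_eqVlt => /predU1P[->//|kl].
by rewrite (le_trans (ih _)) ?(train_mono _ _ _ _ _ _ _ _ uT)// -ltnS kl ltnW.
Qed.

Lemma train_propagate k t : (k <= n)%N ->
  expR (- (alpha * (t - tau k))) * u (tau k) = expR (- (alpha * t)) * u 0 +
  theta * \sum_(0 <= j < k) q j * expR (- (alpha * (t - tau j.+1))).
Proof.
elim: k => [_|k ih kn].
  by rewrite (train_start _ _ _ _ _ _ _ _ uT) subr0 big_geq// mulr0 addr0.
rewrite (train_jump _ _ _ _ _ _ _ _ uT)// mulrDr mulrA -expRD.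
have -> : - (alpha * (t - tau k.+1)) + - (alpha * (tau k.+1 - tau k)) =
  - (alpha * (t - tau k)) by ring.
rewrite ih 1?ltnW// big_nat_recr//=; ring.
Qed.

Lemma train_locate t : 0 <= t -> exists k, [/\ (k <= n)%N, tau k <= t &
  (k < n)%N -> t < tau k.+1].
Proof.
move=> t0; suff h m : (m <= n)%N -> exists k, [/\ (k <= m)%N, tau k <= t &
    (k < m)%N -> t < tau k.+1] by apply: h.
elim: m => [_|m ih mn].
  by exists 0%N; rewrite (train_start _ _ _ _ _ _ _ _ uT).
have [k [km kt tk]] := ih (ltnW mn).
have [tm|mt] := ltP t (tau m.+1); last by exists m.+1; rewrite ltnn.
exists k; split => [||km1]//; first exact: leqW.
by have [/tk//|mk] := ltnP k m; rewrite (_ : k = m)//; apply/eqP; rewrite eqn_leq km.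
Qed.

Lemma train_sum_locate k t : (k <= n)%N -> tau k <= t ->
  ((k < n)%N -> t < tau k.+1) -> train_sum alpha n tau q t =
  \sum_(0 <= j < k) q j * expR (- (alpha * (t - tau j.+1))).
Proof.
move=> kn kt tk; rewrite /train_sum (big_cat_nat (n := k))//=.
rewrite [X in _ + X]big_nat [X in _ + X]big1 ?addr0; last first.
  move=> j /andP[kj jn]; rewrite leNgt (lt_le_trans (tk (leq_ltn_trans kj jn)))//=.
    by rewrite mulr0n mulr0.
  by rewrite train_le// ltnS kj.
rewrite big_nat [RHS]big_nat; apply: eq_bigr => j /andP[_ jk].
by rewrite (le_trans _ kt)// train_le// jk.
Qed.

Lemma train_window t : 0 <= t <= T ->
  `|u t - (expR (- (alpha * t)) * u 0 + theta * train_sum alpha n tau q t)| <=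
  theta.
Proof.
move=> /andP[t0 tT]; have [k [kn kt tk]] := train_locate _ t0.
rewrite (train_sum_locate k)// -train_propagate//.
apply: (train_silent _ _ _ _ _ _ _ _ uT) => //; first by rewrite kt.
by move=> /tk/ltW.
Qed.

Lemma train_after t : 0 <= t -> tau n < t ->
  `|u t - (expR (- (alpha * t)) * u 0 + theta * train_sum alpha n tau q t)| <=
  DC.
Proof.
move=> t0 nt; have -> := train_sum_locate n t (leqnn n) (ltW nt).
  rewrite -train_propagate//; exact: (train_future _ _ _ _ _ _ _ _ uT).
by rewrite ltnn.
Qed.

End OneTrain.

(** Real-valued so that it can be summed into the counting function [m(t)] and integrated; the order
    of [x] and [y] is immaterial. *)
Definition between (x y t : R) : R :=
  ((Num.min x y <= t) && (t <= Num.max x y))%:R.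

Lemma expRN_dist (a b : R) : 0 <= a -> 0 <= b ->
  `|expR (- a) - expR (- b)| <= `|a - b|.
Proof.
wlog ab : a b / a <= b => [wl|a0 b0].
  have [ab|/ltW ba] := leP a b; first exact: wl.
  by move=> a0 b0; rewrite distrC [leRHS]distrC wl.
rewrite ger0_norm ?subr_ge0 ?ler_expR ?lerN2// ler0_norm ?subr_le0// opprB.
have -> : - b = - a + (a - b) by ring.
rewrite expRD -[X in X - _]mulr1 -mulrBr.
have e1 : expR (- a) <= 1 by rewrite -expR0 ler_expR oppr_le0.
have e2 := expR_ge1Dx (a - b).
rewrite (@le_trans _ _ (1 - expR (a - b)))//; last by lra.
rewrite ler_piMl// subr_ge0 -expR0 ler_expR; lra.
Qed.

(** If both impulses have occurred, the exponentials differ by at most [alpha |x - y|]. If exactly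
    one has, the difference is at most 1, and [t] lies between [x] and [y]. *)
Lemma switched_exp_dist alpha (x y t : R) : 0 < alpha ->
  `|expR (- (alpha * (t - x))) *+ (x <= t)%R -
    expR (- (alpha * (t - y))) *+ (y <= t)%R| <=
  alpha * `|x - y| + between x y t.
Proof.
move=> a0; have h (z : R) : z <= t -> 0 <= alpha * (t - z).
  by move=> zt; rewrite mulr_ge0 ?subr_ge0// ltW.
have e1 z : z <= t -> expR (- (alpha * (t - z))) <= 1.
  by move=> zt; rewrite -expR0 ler_expR oppr_le0 h.
have axy : 0 <= alpha * `|x - y| by rewrite mulr_ge0// ltW.
have [xt|tx] := leP x t; have [yt|ty] := leP y t; rewrite ?mulr1n ?mulr0n.
- rewrite ler_wpDr ?ler0n// (le_trans (expRN_dist _ _ _ _)) ?h//.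
  rewrite -mulrBr normrM (gtr0_norm a0) ler_wpM2l ?(ltW a0)//.
  by rewrite distrC (_ : t - y - _ = x - y)//; ring.
- rewrite subr0 ger0_norm ?expR_ge0// /between ge_min xt/= le_max (ltW ty) orbT.
  by rewrite ler_wpDl// e1.
- rewrite sub0r normrN ger0_norm ?expR_ge0// /between ge_min yt orbT/=.
  by rewrite le_max (ltW tx)/= ler_wpDl// e1.
- by rewrite subr0 normr0 addr_ge0// ler0n.
Qed.

Lemma train_sum_dist alpha n tau tau' q t : 0 < alpha ->
  (forall j, (j < n)%N -> `|q j| <= 1) ->
  `|train_sum alpha n tau q t - train_sum alpha n tau' q t| <=
  \sum_(0 <= j < n)
    (alpha * `|tau j.+1 - tau' j.+1| + between (tau j.+1) (tau' j.+1) t).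
Proof.
move=> a0 q1; rewrite /train_sum -sumrB.
rewrite (le_trans (ler_norm_sum _ _ _))// !big_nat ler_sum// => j /andP[_ jn].
rewrite -mulrBr normrM (le_trans _ (switched_exp_dist _ _ _ _ a0))//.
by rewrite ler_piMl// q1.
Qed.

(* On [ [t0, T] ] the memory of the past has decayed below the threshold. *)
Lemma train_dist alpha theta T DC n u u' tau tau' q t0 t :
  0 < alpha -> 0 <= theta -> 0 <= DC ->
  lif_train alpha theta T DC n u tau q ->
  lif_train alpha theta T DC n u' tau' q ->
  tau n <= T -> tau' n <= T ->
  (forall j, (j < n)%N -> `|q j| <= 1) ->
  0 <= t0 -> DC * expR (- (alpha * t0)) <= theta ->
  `|u t - u' t| <=
  2 * theta + theta * \sum_(0 <= j < n)
    (alpha * `|tau j.+1 - tau' j.+1| + between (tau j.+1) (tau' j.+1) t) +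
  (if t0 <= t <= T then 2 * theta else 4 * DC).
Proof.
move=> a0 th0 DC0 uT uT' nT nT' q1 t00 t0DC; set S := \sum_(_ <= _ < _) _.
have S0 : 0 <= theta * S.
  rewrite mulr_ge0// sumr_ge0// => j _.
  by rewrite addr_ge0 ?ler0n// mulr_ge0// ltW.
have u0 := train_past _ _ _ _ _ _ _ _ uT.
have u0' := train_past _ _ _ _ _ _ _ _ uT'.
have [tneg|tpos] := leP t 0.
  rewrite (le_trans (ler_normB _ _))//.
  have := u0 _ tneg; have := u0' _ tneg.
  case: ifPn => [/andP[t0t _]|_]; last by lra.
  (* Here [0 <= t0 <= t <= 0], so [t0 = 0] and the decay hypothesis says that [DC <= theta]. *)
  have : DC <= theta.
    have -> : DC = DC * expR (- (alpha * t0)); last by [].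
    have -> : t0 = 0 by apply/eqP; rewrite eq_le t00 (le_trans t0t).
    by rewrite mulr0 oppr0 expR0 mulr1.
  lra.
have e1 : expR (- (alpha * t)) <= 1.
  by rewrite -expR0 ler_expR oppr_le0 mulr_ge0// ltW.
set E := expR _ in e1; have E0 : 0 <= E by rewrite expR_ge0.
pose rem (v : R -> R) ta :=
  v t - (E * v 0 + theta * train_sum alpha n ta q t).
have split_dist : `|u t - u' t| <= `|rem u tau| + `|rem u' tau'| +
    2 * (DC * E) + theta * S.
  have -> : u t - u' t = rem u tau - rem u' tau' + E * (u 0 - u' 0) +
    theta * (train_sum alpha n tau q t - train_sum alpha n tau' q t).
    by rewrite /rem; ring.
  rewrite (le_trans (ler_normD _ _))// lerD//; last first.
    by rewrite normrM (ger0_norm th0) ler_wpM2l// train_sum_dist.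
  rewrite (le_trans (ler_normD _ _))// lerD ?ler_normB//.
  rewrite normrM (ger0_norm E0) (_ : 2 * _ = E * (2 * DC)); last by ring.
  rewrite ler_wpM2l// (le_trans (ler_normB _ _))//.
  by have := u0 _ (lexx 0); have := u0' _ (lexx 0); lra.
have DCE : DC * E <= DC by rewrite ler_piMr.
have [tT|Tt] := leP t T; last first.
  rewrite andbF.
  have r1 : `|rem u tau| <= DC.
    by apply: (train_after _ _ _ _ _ _ _ _ uT); [exact: ltW|exact: le_lt_trans Tt].
  have r2 : `|rem u' tau'| <= DC.
    by apply: (train_after _ _ _ _ _ _ _ _ uT'); [exact: ltW|exact: le_lt_trans Tt].
  lra.
have r1 : `|rem u tau| <= theta.
  by apply: (train_window _ _ _ _ _ _ _ _ uT); rewrite ltW.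
have r2 : `|rem u' tau'| <= theta.
  by apply: (train_window _ _ _ _ _ _ _ _ uT'); rewrite ltW.
rewrite andbT; case: ifP => [t0t|_]; last by lra.
have : DC * E <= theta.
  rewrite (le_trans _ t0DC)// ler_wpM2l// ler_expR lerN2 ler_wpM2l//.
  exact: ltW.
lra.
Qed.

End Train.

(** * From complex signals and their spikes to real spike trains *)

Section Parts.
Context {R : realType}.
Local Notation mu := (@lebesgue_measure R).
Local Notation integrableT f := (mu.-integrable [set: R] (EFin \o f)).
Local Open Scope complex_scope.
Implicit Types (z : R[i]) (f g : R -> R[i]) (b : bool) (x t alpha theta : R).

Definition part b z : R := if b then complex.Im z else complex.Re z.

Lemma partB b z w : part b (z - w) = part b z - part b w.
Proof. by case: b; case: z => ? ?; case: w. Qed.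

Lemma part_scale b z x : part b (z * x%:C) = part b z * x.
Proof. by case: b; case: z => c d /=; rewrite mulr0 ?subr0 ?add0r. Qed.

Lemma part_le b z : `|part b z| <= modulus z.
Proof.
case: b; case: z => c d; rewrite /modulus/= -sqrtr_sqr ler_wsqrtr//.
  by rewrite lerDr sqr_ge0.
by rewrite lerDl sqr_ge0.
Qed.


Lemma modulusE z : modulus z = Num.sqrt (part false z ^+ 2 + part true z ^+ 2).
Proof. by case: z. Qed.

Lemma modulus_le_parts z : modulus z <= `|part false z| + `|part true z|.
Proof.
rewrite modulusE -[leRHS]ger0_norm ?addr_ge0// -sqrtr_sqr ler_wsqrtr//.
rewrite sqrrD !real_normK ?num_real// lerD2r lerDl mulrn_wge0// mulr_ge0//.
Qed.

Lemma part_leaky_integral b alpha f (D : set R) t :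
  part b (leaky_integral alpha f D t) =
  \int[mu]_(x in D) (part b (f x) * expR (alpha * (x - t))).
Proof.
by case: b; apply: eq_Rintegral => x _; rewrite -part_scale.
Qed.

(** The pair is chosen so that [fourier_cos - i fourier_sin] is [g] for the real part and [- i g]
    for the imaginary part. *)
Definition fourier_cos b g xi : R := part b (g xi).
Definition fourier_sin b g xi : R :=
  if b then complex.Re (g xi) else - complex.Im (g xi).

Lemma fourier_cos_le b g xi : `|fourier_cos b g xi| <= modulus (g xi).
Proof. exact: part_le. Qed.

Lemma fourier_sin_le b g xi : `|fourier_sin b g xi| <= modulus (g xi).
Proof.
rewrite /fourier_sin; case: b; first exact: (part_le false).
by rewrite normrN; exact: (part_le true).
Qed.

Lemma integrable_fourier_cos b g : cintegrable g ->
  integrableT (fourier_cos b g).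
Proof. by case: b => -[]. Qed.

Lemma integrable_fourier_sin b g : cintegrable g ->
  integrableT (fourier_sin b g).
Proof.
case: b => -[gr gi] //.
apply: (integrable_ext _ (fun xi => -1 * complex.Im (g xi))).
  by move=> xi; rewrite mulN1r.
exact: integrable_scale.
Qed.

Section OneSignal.
Variables (f g : R -> R[i]) (b : bool).
Hypotheses (fS : signal f) (fg : integrable_fourier_transform f g).

Lemma measurable_part : measurable_fun [set: R] (fun x => part b (f x)).
Proof. by case: fS => -[fr fi] _; case: b. Qed.

Lemma part_bounded : exists M : R, forall x, `|part b (f x)| <= M.
Proof.
by case: fS => _ [M fM]; exists M => x; rewrite (le_trans (part_le _ _)).
Qed.

Lemma part_synthesis : {ae mu, forall x, part b (f x) =
  synthesis (fourier_cos b g) (fourier_sin b g) x}.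
Proof.
have [M fM] := part_bounded.
have Ai := integrable_fourier_cos b _ fg.1.
have Bi := integrable_fourier_sin b _ fg.1.
have sp : spectral (fun x => part b (f x)) (fourier_cos b g) (fourier_sin b g).
  by have [] := spectral_of_fourier _ _ fg; case: b.
have := bounded_lebesgue_pt _ _ measurable_part fM.
apply: negligibleS => x /=; apply: contra_not => xl.
exact: (spectral_inversion _ _ _ _ _ measurable_part fM Ai Bi sp xl).
Qed.

Variable alpha : R.
Hypothesis alpha0 : 0 < alpha.

Definition past_part t : R := part b (leaky_integral alpha f `]-oo, t] t).

Lemma past_part_leak t :
  past_part t = leak alpha (fourier_cos b g) (fourier_sin b g) t.
Proof.
have [M fM] := part_bounded.
rewrite /past_part part_leaky_integral.
exact: (leaky_past_leak alpha alpha0 _ _ measurable_part fM _ _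
  (integrable_fourier_cos b _ fg.1) (integrable_fourier_sin b _ fg.1)
  part_synthesis).
Qed.

Lemma past_part_window s t : s <= t ->
  past_part t - expR (- (alpha * (t - s))) * past_part s =
  part b (leaky_integral alpha f `[s, t] t).
Proof.
have [M fM] := part_bounded.
move=> st; rewrite /past_part (part_leaky_integral b alpha f `]-oo, t]).
rewrite (part_leaky_integral b alpha f `]-oo, s]).
rewrite (part_leaky_integral b alpha f `[s, t]).
have := leaky_past_split alpha alpha0 _ _ measurable_part fM s t st.
by rewrite /leaky_past => ->; rewrite addrAC subrr add0r.
Qed.

Lemma continuous_past_part : continuous past_part.
Proof.
rewrite (_ : past_part = leak alpha (fourier_cos b g) (fourier_sin b g)).
  apply: continuous_leak => //.
    exact: integrable_fourier_cos fg.1.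
  exact: integrable_fourier_sin fg.1.
by apply/funext => t; exact: past_part_leak.
Qed.

End OneSignal.

Section Crossing.
Variables (f g : R -> R[i]) (alpha theta T : R).
Hypotheses (fS : signal f) (fg : integrable_fourier_transform f g).
Hypotheses (alpha0 : 0 < alpha) (theta0 : 0 < theta).

(** Intermediate values: the leaky integral from [s] starts at 0 and exceeds [theta] at [t]. Its
    components are written through [past_part], which makes [G] continuous on the whole line and not
    only after [s]. *)
Lemma crossing_exists s t : s <= t -> t <= T ->
  theta < modulus (leaky_integral alpha f `[s, t] t) ->
  exists2 c, c <= t & crossings theta alpha T f s c.
Proof.
move=> st tT tht.
pose w b x := past_part f b alpha x -
  expR (- (alpha * (x - s))) * past_part f b alpha s.
pose G x := Num.sqrt (w false x ^+ 2 + w true x ^+ 2).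
have GE x : s <= x -> G x = modulus (leaky_integral alpha f `[s, x] x).
  by move=> sx; rewrite modulusE -!(past_part_window f _ fS)//.
have wc b : continuous (w b).
  move=> x; apply: cvgB; first exact: (continuous_past_part f g b fS fg).
  apply: cvgM; last exact: cvg_cst.
  apply: (@continuous_comp _ _ _ (fun x => - (alpha * (x - s))) expR).
    apply: cvgN; apply: cvgM; first exact: cvg_cst.
    by apply: cvgB; [exact: cvg_id|exact: cvg_cst].
  exact: continuous_expR.
have Gc : continuous G.
  move=> x; apply: (@continuous_comp _ _ _ (fun x => w false x ^+ 2 + w true x ^+ 2)
    Num.sqrt); last exact: sqrt_continuous.
  apply: cvgD.
    apply: (@continuous_comp _ _ _ (w false) (fun y => y ^+ 2)); first exact: wc.
    exact: sqr_continuous.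
  apply: (@continuous_comp _ _ _ (w true) (fun y => y ^+ 2)); first exact: wc.
  exact: sqr_continuous.
have Gs : G s = 0.
  by rewrite /G /w !subrr !mulr0 !oppr0 !expR0 !mul1r !subrr expr0n/= addr0 sqrtr0.
have Gt : theta < G t by rewrite GE.
have [||c] := @IVT _ G s t theta st.
- exact: continuous_subspaceT.
- rewrite Gs min_l ?max_r; [|exact: sqrtr_ge0..].
  by rewrite !ltW.
rewrite in_itv/= => /andP[sc ct] Gcth; exists c => //; split.
  by rewrite sc (le_trans ct).
by rewrite -GE.
Qed.

Lemma firing_time_crossing (s : seq R) k : lif_spikes theta alpha T f s ->
  (k < size s)%N -> crossings theta alpha T f (firing_time s k)
                      (firing_time s k.+1).
Proof. by move=> [sC _] /sC[]. Qed.

(** Exceeding the threshold would force a crossing at or before [t]. After the last spike there is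
    none; otherwise minimality of the next spike forces [t] to be that spike, where the modulus is
    exactly [theta]. *)
Lemma silent_before_firing (s : seq R) k t : lif_spikes theta alpha T f s ->
  (k <= size s)%N -> firing_time s k <= t <= T ->
  ((k < size s)%N -> t <= firing_time s k.+1) ->
  modulus (leaky_integral alpha f `[firing_time s k, t] t) <= theta.
Proof.
move=> [sC slast] ks /andP[kt tT] tk; rewrite leNgt; apply/negP => tht.
have [c ct cC] := crossing_exists _ _ kt tT tht.
move: ks; rewrite leq_eqVlt => /predU1P[kE|ks].
  by move: slast cC; rewrite /last_firing_time -kE => ->.
have [[_ kth] lb] := sC k ks.
have tE : t = firing_time s k.+1.
  by apply/eqP; rewrite eq_le tk//= (le_trans (lb _ cC)).
by move: tht; rewrite tE kth ltxx.
Qed.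

Lemma firing_time_le_T (s : seq R) k : 0 < T -> lif_spikes theta alpha T f s ->
  (k <= size s)%N -> firing_time s k <= T.
Proof.
case: k => [|k] T0 sL ks; first by rewrite ltW.
by have [/andP[]] := firing_time_crossing _ _ sL ks.
Qed.

Variables (alpha1 Dalpha DC : R).
Hypothesis alphaD : `|alpha - alpha1| <= Dalpha.
Hypothesis pastD : (past_uncertainty alpha1 Dalpha f <= DC%:E)%E.
Hypothesis futureD : (future_uncertainty theta alpha T alpha1 Dalpha f <= DC%:E)%E.

Lemma part_phase b (s : seq R) k : lif_spikes theta alpha T f s ->
  (k < size s)%N -> part b (leaky_integral alpha f
    `[firing_time s k, firing_time s k.+1] (firing_time s k.+1)) =
  theta * part b (firing_phase alpha f s k).
Proof.
move=> sL ks; have [_ kth] := firing_time_crossing _ _ sL ks.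
rewrite /firing_phase kth -fmorphV part_scale mulrC divfK// gt_eqF//.
Qed.

Lemma part_phase_le1 b (s : seq R) k : lif_spikes theta alpha T f s ->
  (k < size s)%N -> `|part b (firing_phase alpha f s k)| <= 1.
Proof.
move=> sL ks; rewrite -(ler_pM2l theta0) -[X in X * _](gtr0_norm theta0).
rewrite -normrM -part_phase// mulr1.
have [_ kth] := firing_time_crossing _ _ sL ks.
by rewrite (le_trans (part_le _ _))// kth.
Qed.

Lemma lif_train_part b (s : seq R) : 0 < T -> lif_spikes theta alpha T f s ->
  lif_train alpha theta T DC (size s) (past_part f b alpha) (firing_time s)
    (fun k => part b (firing_phase alpha f s k)).
Proof.
move=> T0 sL; have pw := past_part_window f b fS alpha alpha0.
split => //.
- by move=> k ks; have [/andP[]] := firing_time_crossing _ _ sL ks.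
- move=> k ks; have [/andP[kk1 _] _] := firing_time_crossing _ _ sL ks.
  by rewrite -part_phase// -pw// addrC subrK.
- move=> k t ks kt tk; rewrite pw; last by case/andP: kt.
  by rewrite (le_trans (part_le _ _))// silent_before_firing.
- move=> t st; rewrite pw; last exact: ltW.
  rewrite -lee_fin (le_trans _ futureD)//.
  rewrite (@le_trans _ _ (modulus (leaky_integral alpha f
    `[last_firing_time s, t] t))%:E)// ?lee_fin ?part_le//.
  (* The suprema over admissible leakages are used at the actual leakage [alpha]. *)
  by apply: ereal_sup_ubound; exists s, t, alpha.
- move=> t t0; rewrite -lee_fin (le_trans _ pastD)//.
  rewrite (@le_trans _ _ (modulus (leaky_integral alpha f `]-oo, t] t))%:E)//.
    by rewrite lee_fin part_le.
  by apply: ereal_sup_ubound; exists t, alpha.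
Qed.

End Crossing.
End Parts.

(** * The stencil *)

Section Weights.
Context {R : realType}.
Implicit Types (x a s : R) (m k N : nat).

Lemma norm_sin_le x : `|sin x| <= `|x|.
Proof.
have := @mean_value_bound R (@sin R) (@cos R) 1 `|x| x (normr_ge0 _) (lexx _)
  (fun y _ => is_derive_sin y) (fun y _ => cos_max y).
by rewrite sin0 subr0 mul1r.
Qed.

Lemma sum_odd_coef_le N : \sum_(0 <= k < N) (odd_coef k ^+ 2)^-1 <= 3 :> R.
Proof.
(* Strengthened for induction: with [o = odd_coef N], the increment
   [2 / o - 2 / (o + 2) = 4 / (o (o + 2))] dominates [1 / o^2]. *)
suff : \sum_(0 <= k < N) (odd_coef k ^+ 2)^-1 <= 3 - 2 / odd_coef N :> R.
  by move/le_trans; apply; rewrite gerBl divr_ge0// ltW// odd_coef_gt0.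
elim: N => [|N ih].
  by rewrite big_geq// /odd_coef muln0 add0n divr1; lra.
rewrite big_nat_recr//= (le_trans (lerD ih (lexx _)))//.
have n0 : 0 <= N%:R :> R by [].
have o1 := @odd_coef_gt0 R N; have o2 := @odd_coef_gt0 R N.+1.
rewrite -subr_ge0.
have -> : 3 - 2 / odd_coef N.+1 - (3 - 2 / odd_coef N + (odd_coef N ^+ 2)^-1) =
    (4 * odd_coef N - odd_coef N.+1) / (odd_coef N ^+ 2 * odd_coef N.+1) :> R.
  have e : odd_coef N.+1 = odd_coef N + 2 :> R by rewrite !odd_coefE -natr1; ring.
  move: o1 o2; rewrite e; move: (odd_coef N) => o /lt0r_neq0 o1 /lt0r_neq0 o2.
  by field; rewrite o1 o2.
rewrite divr_ge0 ?mulr_ge0 ?sqr_ge0 ?(ltW o2)// !odd_coefE -natr1; lra.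
Qed.

Lemma wave_weight_norm m a k : `|wave_weight m a k| =
  (odd_coef k ^+ 2)^-1 * `|sin (odd_coef k * a) / (odd_coef k * a)| ^+ m.
Proof.
rewrite /wave_weight normrM normrX; congr (_ * _).
rewrite normrM normfV !normrX normrN1 expr1n mul1r.
by rewrite (gtr0_norm (odd_coef_gt0 k)).
Qed.

Lemma wave_weight_le m a k : `|wave_weight m a k| <= (odd_coef k ^+ 2)^-1.
Proof.
rewrite wave_weight_norm ler_piMr ?invr_ge0 ?sqr_ge0// exprn_ile1//.
rewrite normrM normfV; have [->|z0] := eqVneq (odd_coef k * a) 0.
  by rewrite normr0 invr0 mulr0.
by rewrite ler_pdivrMr ?normr_gt0// mul1r norm_sin_le.
Qed.

Lemma expR1_le4 : expR 1 <= 4 :> R.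
Proof.
have h : 1 / 2 <= expR (- (1 / 2)) :> R.
  by rewrite (le_trans _ (expR_ge1Dx _))//; lra.
have -> : 1 = 1 / 2 + 1 / 2 :> R by lra.
rewrite expRD; move: h; rewrite expRN; set e := expR _ => h.
have e0 : 0 < e by exact: expR_gt0.
have : e <= 2.
  by move: h; rewrite div1r lef_pV2 ?posrE.
by move=> e2; rewrite (le_trans (ler_pM _ _ e2 e2)) ?(ltW e0)//; lra.
Qed.

Lemma le_expR_logp DC theta : 0 < theta -> 0 <= DC ->
  DC <= theta * expR (logp (DC / theta)) :> R.
Proof.
move=> th0; rewrite le_eqVlt => /predU1P[<-|DC0].
  by rewrite mulr_ge0 ?expR_ge0// ltW.
rewrite -ler_pdivrMl// mulrC -[leLHS]lnK ?posrE ?divr_gt0// ler_expR.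
by rewrite /logp le_max lexx orbT.
Qed.

(* Far from its center the stencil absorbs the uncertainty [DC = theta e^s]. *)
Lemma wave_weight_far m k s theta DC : (0 < m)%N -> 0 <= s -> 0 < theta ->
  0 <= DC -> DC <= theta * expR s -> m%:R <= s + 1 -> s <= m%:R ->
  32 * s ^+ 2 <= odd_coef k ->
  `|wave_weight m (4 * m%:R)^-1 k| * DC <= (odd_coef k ^+ 2)^-1 * (4 * theta).
Proof.
move=> m0 s0 th0 DC0 DCs ms sm sk.
(* If [s <= 1] then [DC <= e theta <= 4 theta], and the plain bound on the weight suffices. *)
have [s1|s1] := leP s 1.
  apply: ler_pM => //; first exact: wave_weight_le.
  rewrite (le_trans DCs)// mulrC ler_wpM2r ?(ltW th0)//.
  by rewrite (le_trans _ expR1_le4)// ler_expR.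
rewrite wave_weight_norm -mulrA ler_wpM2l ?invr_ge0 ?sqr_ge0//.
have m0' : 0 < m%:R :> R by rewrite ltr0n.
set z := odd_coef k * _.
(* Since [m <= s + 1 <= 2 s], the claim [16 m <= odd_coef k] follows from
   [32 s <= 32 s^2 <= odd_coef k]. *)
have z4 : 4 <= z.
  rewrite /z ler_pdivlMr ?mulr_gt0// (le_trans _ sk)//.
  have : m%:R <= 2 * s by lra.
  have : s <= s ^+ 2 by rewrite expr2 ler_peMr// ltW.
  lra.
have sinc4 : `|sin z / z| <= 4^-1.
  rewrite normrM normfV -[leRHS]mul1r ler_pM ?invr_ge0 ?sin_max//.
  by rewrite lef_pV2 ?posrE ?normr_gt0 ?gt_eqF// ?(lt_le_trans _ z4)//
    (le_trans z4)// ler_norm.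
apply: (@le_trans _ _ (4^-1 ^+ m * (theta * expR m%:R))).
  apply: ler_pM; rewrite ?exprn_ge0//.
    by rewrite lerXn2r// nnegrE invr_ge0.
  by rewrite (le_trans DCs)// ler_wpM2l ?(ltW th0)// ler_expR.
(* Each of the [m] averages gains 1/4, and [e <= 4] pays for one unit of the exponent. *)
have e4 : 4^-1 ^+ m * expR m%:R <= 1 :> R.
  rewrite -[m%:R]mulr1 expRM_natl -exprMn exprn_ile1//.
  by rewrite mulrC ler_pdivrMr// mul1r expR1_le4.
rewrite mulrCA (le_trans (ler_wpM2l (ltW th0) e4))//; lra.
Qed.

End Weights.

(** * Recovering [v' + alpha v] from samples of a band-limited [v] *)

Section Stencil.
Context {R : realType}.
Local Notation mu := (@lebesgue_measure R).
Local Notation integrableT f := (mu.-integrable [set: R] (EFin \o f)).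
Variables (m n : nat) (alpha h Omega : R).
Hypotheses (m0 : (0 < m)%N) (n0 : (0 < n)%N).
Hypotheses (alpha0 : 0 < alpha) (alphaO : alpha <= Omega).
Hypotheses (hO : h <= (4 * pi * Omega)^-1) (Oh : (8 * pi * Omega)^-1 <= h).
Implicit Types (x t xi w p q : R) (A B v : R -> R).

Local Notation D := (slope n.*2 : R).
Local Notation weight := (wave_weight m (4 * m%:R)^-1 : nat -> R).
Local Notation wave := (wave m (4 * m%:R)^-1 n.*2).

Let O0 : 0 < Omega. Proof. exact: lt_le_trans alphaO. Qed.
Let h0 : 0 < h.
Proof. by apply: lt_le_trans Oh; rewrite invr_gt0 !mulr_gt0// pi_gt0. Qed.
Let D2 : 1 / 2 <= D.
Proof. by case: n n0 => // k _; exact: slope_ge_half. Qed.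
Let D0 : 0 < D. Proof. by move: D2; lra. Qed.
Let Dinv : D^-1 <= 2.
Proof. by rewrite -[leRHS]invrK lef_pV2 ?posrE// -div1r. Qed.
Let hinv : h^-1 <= 8 * pi * Omega.
Proof.
by rewrite -[leRHS]invrK lef_pV2 ?posrE ?invr_gt0// !mulr_gt0// pi_gt0.
Qed.

(** The part [+- (2 D h)^-1], antisymmetric between right and left, yields [v'] because [wave (w h)]
    is close to [D w h]. The symmetric part yields [alpha v] because
    [wave (1/4 + w h) + wave (1/4 - w h)] is close to [D / 2]. *)
Definition stencil_right k : R :=
  weight k * ((2 * D * h)^-1 + 2 * alpha * sin (odd_coef k / 4) / D).
Definition stencil_left k : R :=
  weight k * (- (2 * D * h)^-1 + 2 * alpha * sin (odd_coef k / 4) / D).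

(* [stencil v x] recovers [v' + alpha v] at [x] for [v] of bandwidth [Omega]. *)
Definition stencil v x : R := \sum_(0 <= k < n.*2)
  (stencil_right k * v (x + odd_coef k * h) +
   stencil_left k * v (x - odd_coef k * h)).

(** [36 = 32 + 4]: with [1 / D <= 2] and [1 / h <= 8 pi Omega], the first summand is at most
    [8 pi Omega <= 32 Omega], the second at most [4 Omega]. *)
Lemma stencil_coef_le k : `|stencil_right k| <= 36 * Omega * `|weight k| /\
  `|stencil_left k| <= 36 * Omega * `|weight k|.
Proof.
have pO : pi * Omega <= 4 * Omega.
  by rewrite ler_wpM2r ?(ltW O0)//; have := @pihalf_lt2 R; lra.
have b0 : 0 <= (2 * D * h)^-1 by rewrite invr_ge0 !mulr_ge0// ltW.
have b1 : (2 * D * h)^-1 <= 32 * Omega.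
  have : D^-1 * h^-1 <= 2 * (8 * pi * Omega).
    by apply: ler_pM => //; rewrite invr_ge0 ltW.
  have -> : (2 * D * h)^-1 = D^-1 * h^-1 / 2 by rewrite !invfM; ring.
  lra.
have b2 : `|2 * alpha * sin (odd_coef k / 4) / D| <= 4 * Omega.
  rewrite normrM normrM (ger0_norm (_ : 0 <= 2 * alpha)) ?mulr_ge0 ?(ltW alpha0)//.
  rewrite (ger0_norm (_ : 0 <= D^-1)) ?invr_ge0 ?(ltW D0)//.
  have -> : 4 * Omega = (2 * Omega) * 1 * 2 by ring.
  by rewrite !ler_pM ?mulr_ge0 ?invr_ge0 ?(ltW alpha0) ?(ltW D0) ?sin_max ?ler_wpM2l.
rewrite !normrM [36 * Omega * _]mulrC !ler_wpM2l// (le_trans (ler_normD _ _))//;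
  rewrite ?normrN (ger0_norm b0); lra.
Qed.

Lemma stencil_cos_sin p q w x :
  stencil (fun t => p * cos (w * t) + q * sin (w * t)) x =
  (q * cos (w * x) - p * sin (w * x)) * (wave (w * h) / (D * h)) +
  alpha * (p * cos (w * x) + q * sin (w * x)) *
    (2 * (wave (1 / 4 + w * h) + wave (1 / 4 - w * h)) / D).
Proof.
rewrite /stencil /stencil_right /stencil_left.
have := lt0r_neq0 D0; move: D => d d0.
rewrite /wave -[X in _ + _ * (2 * X / d)]big_split/=.
rewrite [2 * \sum_(_ <= _ < _) _]mulr_sumr !mulr_suml !mulr_sumr -big_split/=.
apply: eq_bigr => k _.
have -> : w * (x + odd_coef k * h) = w * x + odd_coef k * (w * h) by ring.
have -> : w * (x - odd_coef k * h) = w * x - odd_coef k * (w * h) by ring.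
have -> : odd_coef k * (1 / 4 + w * h) = odd_coef k / 4 + odd_coef k * (w * h).
  by field.
have -> : odd_coef k * (1 / 4 - w * h) = odd_coef k / 4 - odd_coef k * (w * h).
  by field.
move: (weight k) (odd_coef k * (w * h)) (odd_coef k / 4) => c y z.
rewrite !sinB !cosB !sinD !cosD.
by field; rewrite d0 gt_eqF.
Qed.

Lemma wave_le x : `|wave x| <= 3.
Proof.
rewrite (le_trans (ler_norm_sum _ _ _))// (le_trans _ (sum_odd_coef_le n.*2))//.
apply: ler_sum => k _; rewrite normrM (le_trans _ (wave_weight_le m (4 * m%:R)^-1 k))//.
by rewrite ler_piMr// sin_max.
Qed.

Let K : R := (cos 1) ^- 2.

(** The [m] averages use up [m * (4 m)^-1 = 1/4] of the unit range. *)
Let wave_D x : `|x| <= 3 / 4 -> `|wave x - D * x| <= K / n.*2%:R.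
Proof.
move=> x34; apply: wave_linear => //; first by rewrite invr_gt0 mulr_gt0// ltr0n.
rewrite invfM mulrCA mulfV ?mulr1; last by rewrite pnatr_eq0 -lt0n.
lra.
Qed.

Let norm_pm x y c s : `|c| <= 1 -> `|s| <= 1 -> `|x * c + y * s| <= `|x| + `|y| :> R.
Proof.
move=> c1 s1; rewrite (le_trans (ler_normD _ _))// !normrM.
by rewrite lerD// ler_piMr.
Qed.

(* The stencil is exact in the limit [n -> oo] on the frequencies [|w| h <= 1/2]. *)
Lemma stencil_low p q w x : `|w| * h <= 1 / 2 ->
  `|w * (q * cos (w * x) - p * sin (w * x)) +
    alpha * (p * cos (w * x) + q * sin (w * x)) -
    stencil (fun t => p * cos (w * t) + q * sin (w * t)) x| <=
  (`|p| + `|q|) * (2 / h + 8 * alpha) * (K / n.*2%:R).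
Proof.
move=> wh; rewrite stencil_cos_sin.
set e1 := q * _ - _; set e2 := p * _ + _.
have e1l : `|e1| <= `|p| + `|q|.
  rewrite /e1 addrC -mulrN norm_pm ?normrN ?sin_max ?cos_max//.
have e2l : `|e2| <= `|p| + `|q| by rewrite norm_pm ?sin_max ?cos_max.
set k := K / _.
have wh' : `|w * h| <= 1 / 2 by rewrite normrM (gtr0_norm h0).
have k1 : `|wave (w * h) - D * (w * h)| <= k by apply: wave_D; lra.
have k2 : `|wave (1 / 4 + w * h) - D * (1 / 4 + w * h)| <= k.
  by apply: wave_D; move: wh'; rewrite !ler_norml; lra.
have k3 : `|wave (1 / 4 - w * h) - D * (1 / 4 - w * h)| <= k.
  by apply: wave_D; move: wh'; rewrite !ler_norml; lra.
set a1 := wave (w * h) in k1 *; set a2 := wave (_ + _) in k2 *.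
set a3 := wave (_ - _) in k3 *.
have -> : w * e1 + alpha * e2 - (e1 * (a1 / (D * h)) +
    alpha * e2 * (2 * (a2 + a3) / D)) =
  - (e1 * ((a1 - D * (w * h)) / (D * h))) - alpha * (e2 * (2 *
    ((a2 - D * (1 / 4 + w * h)) + (a3 - D * (1 / 4 - w * h))) / D)).
  move: D (lt0r_neq0 D0) => d d0.
  by field; rewrite d0 gt_eqF.
have b1 : `|(a1 - D * (w * h)) / (D * h)| <= k * (2 / h).
  rewrite normrM ler_pM// ger0_norm ?invr_ge0 ?mulr_ge0 ?(ltW D0) ?(ltW h0)//.
  by rewrite invfM ler_wpM2r ?invr_ge0 ?(ltW h0).
have b2 : `|2 * ((a2 - D * (1 / 4 + w * h)) + (a3 - D * (1 / 4 - w * h))) / D|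
    <= (4 * k) * 2.
  rewrite normrM ler_pM//; last by rewrite ger0_norm ?invr_ge0 ?(ltW D0).
  rewrite normrM ger0_norm//.
  have := le_trans (ler_normD _ _) (lerD k2 k3); lra.
rewrite (le_trans (ler_normB _ _))// normrN.
have pq0 : 0 <= `|p| + `|q| by rewrite addr_ge0.
have c1 : `|e1| * `|(a1 - D * (w * h)) / (D * h)| <= (`|p| + `|q|) * (k * (2 / h)).
  by rewrite ler_pM.
have c2 : alpha * (`|e2| * `|2 * ((a2 - D * (1 / 4 + w * h)) +
    (a3 - D * (1 / 4 - w * h))) / D|) <= alpha * ((`|p| + `|q|) * ((4 * k) * 2)).
  by rewrite ler_wpM2l ?(ltW alpha0)// ler_pM.
have -> : (`|p| + `|q|) * (2 / h + 8 * alpha) * k = (`|p| + `|q|) * (k * (2 / h)) +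
  alpha * ((`|p| + `|q|) * ((4 * k) * 2)) by ring.
rewrite lerD//; first by rewrite normrM.
by rewrite normrM (gtr0_norm alpha0) [`|e2 * _|]normrM.
Qed.

Lemma stencil_high p q w x :
  `|stencil (fun t => p * cos (w * t) + q * sin (w * t)) x| <=
  (`|p| + `|q|) * (6 / h + 24 * alpha).
Proof.
rewrite stencil_cos_sin.
set e1 := q * _ - _; set e2 := p * _ + _.
have e1l : `|e1| <= `|p| + `|q|.
  rewrite /e1 addrC -mulrN norm_pm ?normrN ?sin_max ?cos_max//.
have e2l : `|e2| <= `|p| + `|q| by rewrite norm_pm ?sin_max ?cos_max.
set a1 := wave _; set a2 := wave _; set a3 := wave _.
have b1 : `|a1 / (D * h)| <= 6 / h.
  rewrite normrM invfM normrM (gtr0_norm (_ : 0 < D^-1)) ?invr_gt0//.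
  rewrite (gtr0_norm (_ : 0 < h^-1)) ?invr_gt0// mulrA ler_wpM2r ?invr_ge0 ?(ltW h0)//.
  have -> : 6 = 3 * 2 :> R by lra.
  by rewrite ler_pM ?wave_le// invr_ge0 ltW.
have b2 : `|2 * (a2 + a3) / D| <= 24.
  have -> : 24 = 12 * 2 :> R by lra.
  rewrite normrM ler_pM//; last by rewrite ger0_norm ?invr_ge0 ?(ltW D0).
  rewrite normrM ger0_norm//.
  have := le_trans (ler_normD a2 a3) (lerD (wave_le _) (wave_le _)); lra.
rewrite (le_trans (ler_normD _ _))// [leRHS]mulrDr lerD//.
  by rewrite normrM ler_pM.
have -> : (`|p| + `|q|) * (24 * alpha) = alpha * ((`|p| + `|q|) * 24) by ring.
rewrite -[alpha * e2 * _]mulrA normrM (gtr0_norm alpha0).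
by rewrite ler_wpM2l ?(ltW alpha0)// normrM ler_pM.
Qed.

Lemma Rintegral_sum_osc A B N (c d y z : nat -> R) :
  integrableT A -> integrableT B ->
  integrableT (fun xi => \sum_(0 <= k < N)
    (c k * osc A B (y k) xi + d k * osc A B (z k) xi)) /\
  \int[mu]_xi (\sum_(0 <= k < N)
    (c k * osc A B (y k) xi + d k * osc A B (z k) xi)) =
  \sum_(0 <= k < N) (c k * synthesis A B (y k) + d k * synthesis A B (z k)).
Proof.
move=> Ai Bi; have osci t := integrable_osc A B t Ai Bi.
have terms k : integrableT (fun xi => c k * osc A B (y k) xi +
    d k * osc A B (z k) xi).
  by apply: integrable_add => //; exact: integrable_scale.
elim: N => [|N [ih1 ih2]].
  split; last first.
    rewrite big_geq//; under eq_Rintegral do rewrite big_geq//.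
    by rewrite Rintegral_cst// mul0r.
  apply: (integrable_ext _ (cst 0)); last exact: integrable0.
  by move=> xi; rewrite big_geq.
split.
  apply: (integrable_ext _ (fun xi => \sum_(0 <= k < N)
    (c k * osc A B (y k) xi + d k * osc A B (z k) xi) +
    (c N * osc A B (y N) xi + d N * osc A B (z N) xi))).
    by move=> xi; rewrite big_nat_recr.
  exact: integrable_add.
rewrite big_nat_recr//= -ih2.
transitivity (\int[mu]_xi (\sum_(0 <= k < N)
    (c k * osc A B (y k) xi + d k * osc A B (z k) xi) +
    (c N * osc A B (y N) xi + d N * osc A B (z N) xi))).
  by apply: eq_Rintegral => xi _; rewrite big_nat_recr.
rewrite RintegralD//; congr (_ + _).
by rewrite RintegralD ?RintegralZl//; exact: integrable_scale.
Qed.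

Section StencilLeak.
Variables (A B : R -> R).
Hypotheses (Ai : integrableT A) (Bi : integrableT B).

Let V := leak alpha A B.
Let high : set R := [set xi : R | Omega < `|xi|].

Let measurable_high : measurable high.
Proof.
rewrite (_ : high = (fun x : R => `|x|) @^-1` `]Omega, +oo[%classic).
  by rewrite -[_ @^-1` _]setTI; exact: normr_measurable.
by apply/seteqP; split => x /=; rewrite in_itv/= andbT.
Qed.

Let leak_osc x xi : osc A B x xi =
  2 * pi * xi * (leak_sin alpha A B xi * cos (2 * pi * xi * x) -
                 leak_cos alpha A B xi * sin (2 * pi * xi * x)) +
  alpha * osc (leak_cos alpha A B) (leak_sin alpha A B) x xi.
Proof.
rewrite /osc /leak_cos /leak_sin; move: (2 * pi * xi) => w.
have d0 : alpha ^+ 2 + w ^+ 2 != 0.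
  by rewrite gt_eqF// ltr_wpDr ?sqr_ge0// exprn_gt0.
by field.
Qed.

(** The factor [1 / alpha] is harmless: this constant only occurs multiplied by [1 / n], which tends
    to 0. *)
Let low_const : R := 2 / alpha * (16 * pi * Omega + 8 * alpha).

Let stencil_osc_low x xi : `|xi| <= Omega ->
  `|osc A B x xi - stencil
     (fun t => osc (leak_cos alpha A B) (leak_sin alpha A B) t xi) x| <=
  low_const * (K / n.*2%:R) * (`|A xi| + `|B xi|).
Proof.
move=> xiO; rewrite leak_osc.
have p0 := @pi_gt0 R.
have wh : `|2 * pi * xi| * h <= 1 / 2.
  rewrite normrM (gtr0_norm (_ : 0 < 2 * pi)) ?mulr_gt0//.
  have -> : 1 / 2 = 2 * pi * Omega * (4 * pi * Omega)^-1.
    have := lt0r_neq0 O0; move: (pi : R) p0 => p /lt0r_neq0 p0 O0'.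
    by field; rewrite ?p0 ?O0'.
  by rewrite ler_pM ?mulr_ge0 ?(ltW p0) ?(ltW h0)// ler_wpM2l// mulr_ge0 ?(ltW p0).
have := stencil_low (leak_cos alpha A B xi) (leak_sin alpha A B xi) _ x wh.
move/le_trans; apply; rewrite [leRHS]mulrAC; apply: ler_wpM2r.
  by rewrite divr_ge0// invr_ge0 sqr_ge0.
have -> : low_const * (`|A xi| + `|B xi|) =
    (2 * (alpha^-1 * (`|A xi| + `|B xi|))) * (16 * pi * Omega + 8 * alpha).
  by rewrite /low_const; ring.
apply: ler_pM; first exact: addr_ge0.
- by rewrite addr_ge0 ?divr_ge0 ?mulr_ge0 ?(ltW h0) ?(ltW alpha0).
- have := leak_cos_le alpha A B alpha0 xi; have := leak_sin_le alpha A B alpha0 xi.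
  lra.
- by rewrite lerD2r; move: hinv; lra.
Qed.

(** The stencil has size at most [60 pi Omega], while division by the symbol makes the coefficients
    of [leak] at most [2 (|A| + |B|) / (2 pi Omega)]. The powers of [Omega] cancel, leaving 60, plus
    1 for [osc] itself. *)
Let stencil_osc_high x xi : Omega < `|xi| ->
  `|osc A B x xi - stencil
     (fun t => osc (leak_cos alpha A B) (leak_sin alpha A B) t xi) x| <=
  61 * (`|A xi| + `|B xi|).
Proof.
move=> Oxi; have p0 := @pi_gt0 R.
have w0 : 0 < 2 * pi * `|xi| by rewrite !mulr_gt0// (lt_trans O0).
rewrite (le_trans (ler_normB _ _))//.
have -> : 61 * (`|A xi| + `|B xi|) = (`|A xi| + `|B xi|) +
  60 * (`|A xi| + `|B xi|) by ring.
rewrite lerD ?osc_le// (le_trans (stencil_high _ _ _ _))//.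
have pq : `|leak_cos alpha A B xi| + `|leak_sin alpha A B xi| <=
    (2 * pi * `|xi|)^-1 * (2 * (`|A xi| + `|B xi|)).
  rewrite ler_pdivlMl//.
  have := omega_leak_cos_le alpha A B alpha0 xi.
  have := omega_leak_sin_le alpha A B alpha0 xi.
  rewrite !(normrM (2 * pi * xi)) normrM (gtr0_norm (_ : 0 < 2 * pi)) ?mulr_gt0//.
  by rewrite mulrDr; lra.
have wO : (2 * pi * `|xi|)^-1 <= (2 * pi * Omega)^-1.
  by rewrite lef_pV2 ?posrE// ?mulr_gt0// ler_wpM2l ?mulr_ge0 ?(ltW p0)// ltW.
have hc : 6 / h + 24 * alpha <= 60 * (pi * Omega).
  have : 2 * Omega <= pi * Omega by rewrite ler_wpM2r ?(ltW O0)// pi_ge2.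
  by move: hinv alphaO; lra.
have AB0 : 0 <= 2 * (`|A xi| + `|B xi|) by rewrite mulr_ge0// addr_ge0.
apply: (@le_trans _ _ ((2 * pi * Omega)^-1 * (2 * (`|A xi| + `|B xi|)) *
    (60 * (pi * Omega)))).
  apply: ler_pM => //.
    by rewrite addr_ge0 ?divr_ge0 ?mulr_ge0 ?(ltW h0) ?(ltW alpha0).
  by rewrite (le_trans pq)// ler_wpM2r.
rewrite le_eqVlt; apply/orP; left; apply/eqP.
have := lt0r_neq0 O0; move: (pi : R) p0 => p /lt0r_neq0 p0' O0'.
by field; rewrite ?p0' ?O0'.
Qed.

Lemma stencil_error x : `|synthesis A B x - stencil V x| <=
  low_const * (K / n.*2%:R) * (\int[mu]_xi (`|A xi| + `|B xi|)) +
  61 * \int[mu]_(xi in high) (`|A xi| + `|B xi|).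
Proof.
have Pi := integrable_leak_cos alpha A B alpha0 Ai Bi.
have Qi := integrable_leak_sin alpha A B alpha0 Ai Bi.
have [si sE] := Rintegral_sum_osc _ _ n.*2 stencil_right stencil_left
  (fun k => x + odd_coef k * h) (fun k => x - odd_coef k * h) Pi Qi.
rewrite /stencil -sE.
have osci := integrable_osc A B x Ai Bi.
have ABi := integrable_norm_add A B Ai Bi.
have tailE : \int[mu]_(xi in high) (`|A xi| + `|B xi|) =
    \int[mu]_xi (((fun xi => `|A xi| + `|B xi|) \_ high) xi).
  by rewrite Rintegral_mkcond.
have taili : integrableT ((fun xi => `|A xi| + `|B xi|) \_ high).
  have hi : mu.-integrable high (EFin \o (fun xi => `|A xi| + `|B xi|)).
    exact: (integrableS _ _ (@subsetT _ _) ABi).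
  have := (@integrable_mkcond _ _ _ mu high _ measurable_high).1 hi.
  by rewrite restrict_EFin.
rewrite tailE -!RintegralZl// -RintegralB// -RintegralD//; last 2 first.
- exact: integrable_scale.
- exact: integrable_scale.
have di : integrableT (fun xi => osc A B x xi - \sum_(0 <= k < n.*2)
    (stencil_right k *
       osc (leak_cos alpha A B) (leak_sin alpha A B) (x + odd_coef k * h) xi +
     stencil_left k *
       osc (leak_cos alpha A B) (leak_sin alpha A B) (x - odd_coef k * h) xi)).
  by have := integrableB measurableT osci si.
rewrite (le_trans (le_normr_Rintegral _ di))//.
apply: le_Rintegral => //.
- exact: integrable_norm.
- by apply: integrable_add => //; exact: integrable_scale.
move=> xi _; rewrite patchE; case: ifPn; rewrite ?inE ?notin_setE /high/= => xiO.
  rewrite (le_trans (stencil_osc_high x xi xiO))// lerDr.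
  rewrite !mulr_ge0 ?addr_ge0 ?mulr_ge0 ?divr_ge0 ?invr_ge0 ?sqr_ge0//.
  - exact: ltW alpha0.
  - by rewrite pi_ge0.
  - exact: ltW O0.
  - exact: ltW alpha0.
rewrite mulr0 addr0; apply: stencil_osc_low.
by rewrite leNgt; apply/negP.
Qed.

End StencilLeak.

End Stencil.

(** * Averaging over the step of the stencil *)

Section Averaging.
Context {R : realType}.
Local Notation mu := (@lebesgue_measure R).
Variables (a b : R).
Hypothesis ab : a <= b.
Implicit Types (G H : R -> R) (S c x o p q : R).

(** The integral is not divided by [b - a]. Bundling integrability with the bound lets such
    estimates be added without side conditions. *)
Definition mean_le G S : Prop :=
  mu.-integrable `[a, b] (EFin \o G) /\ \int[mu]_(h in `[a, b]) G h <= S.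

Lemma mean_le_add G H S S' : mean_le G S -> mean_le H S' ->
  mean_le (fun h => G h + H h) (S + S').
Proof.
move=> [Gi GS] [Hi HS]; split; first exact: integrable_add.
by rewrite RintegralD// lerD.
Qed.

Lemma mean_le_scale c G S : 0 <= c -> mean_le G S ->
  mean_le (fun h => c * G h) (c * S).
Proof.
move=> c0 [Gi GS]; split; first exact: integrable_scale.
by rewrite RintegralZl// ler_wpM2l.
Qed.

Lemma mean_le_cst c : mean_le (fun=> c) (c * (b - a)).
Proof.
split; last first.
  rewrite Rintegral_cst//= lebesgue_measure_itv/= lte_fin; case: ltP => //= ba.
  by rewrite (_ : b = a) ?subrr//; apply/eqP; rewrite eq_le ba.
apply: measurable_bounded_integrable => //.
- by rewrite /= lebesgue_measure_itv/=; case: ifP => // _; rewrite -EFinB ltry.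
- exists `|c|; split; first by rewrite num_real.
  by move=> M cM y _ /=; exact: ltW.
Qed.

Lemma mean_le_sum N (G : nat -> R -> R) (S : nat -> R) :
  (forall k, mean_le (G k) (S k)) ->
  mean_le (fun h => \sum_(0 <= k < N) G k h) (\sum_(0 <= k < N) S k).
Proof.
move=> GS; elim: N => [|N ih].
  rewrite big_geq// (_ : (fun h => _) = fun=> 0); last first.
    by apply/funext => h; rewrite big_geq.
  by have := mean_le_cst 0; rewrite mul0r.
rewrite big_nat_recr//= (_ : (fun h => _) =
  fun h => \sum_(0 <= k < N) G k h + G N h); last first.
  by apply/funext => h; rewrite big_nat_recr.
exact: mean_le_add.
Qed.

Lemma mean_le_indic (u v : R) : u <= v -> mean_le \1_(`[u, v]%classic) (v - u).
Proof.
move=> uv; split.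
  apply: (integrableS measurableT) => //; exact: integrable_indic_itv.
rewrite /Rintegral integral_indic//.
have mI : (mu (`[u, v] `&` `[a, b]) <= (v - u)%:E)%E.
  apply: (@le_trans _ _ (mu `[u, v])).
    by apply: le_measure; rewrite ?inE//; exact: measurableI.
  rewrite lebesgue_measure_itv/= lte_fin; case: ltP => // _.
  by rewrite lee_fin subr_ge0.
by rewrite -lee_fin fineK// ge0_fin_numE// (le_lt_trans mI)// ltry.
Qed.

(** The map [h |-> x + o h] expands lengths by [|o| >= 1], so the steps that land between [p] and
    [q] have measure at most [|p - q|]. Negative [o] covers the samples on the left. *)
Lemma mean_le_between p q x o : 1 <= `|o| ->
  mean_le (fun h => between p q (x + o * h)) `|p - q|.
Proof.
move=> o1.
have len : Num.max p q - Num.min p q = `|p - q|.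
  case: (leP p q) => [|/ltW] pq.
    by rewrite ler0_norm ?subr_le0// opprB.
  by rewrite ger0_norm ?subr_ge0.
have le_div (c : R) : 0 <= c -> c / `|o| <= c.
  by move=> c0; rewrite ler_pdivrMr ?(lt_le_trans ltr01)// ler_peMr.
have mm : Num.min p q <= Num.max p q by rewrite ge_min !le_max lexx.
have [ oge0 | olt0 ] := leP 0 o.
  have o0' : 0 < o by rewrite ger0_norm// in o1; exact: lt_le_trans o1.
  have le_ends : (Num.min p q - x) / o <= (Num.max p q - x) / o.
    by rewrite ler_wpM2r ?invr_ge0// lerB.
  have := mean_le_indic _ _ le_ends; rewrite /mean_le.
  rewrite (_ : \1_ _ = fun h => between p q (x + o * h)) => [[Gi GS]|].
    split => //; rewrite (le_trans GS)// -mulrBl opprB addrA subrK len.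
    by rewrite -{1}(ger0_norm oge0) le_div.
  apply/funext => h; rewrite indicE /between mem_setE in_itv/=.
  by rewrite ler_pdivrMr// ler_pdivlMr// lerBlDl lerBrDl (mulrC o).
have le_ends : (Num.max p q - x) / o <= (Num.min p q - x) / o.
  by rewrite ler_wnM2r ?invr_le0 ?(ltW olt0)// lerB.
have := mean_le_indic _ _ le_ends; rewrite /mean_le.
rewrite (_ : \1_ _ = fun h => between p q (x + o * h)) => [[Gi GS]|].
  split => //; rewrite (le_trans GS)// -mulrBl -[leLHS]mulrNN opprB opprB.
  rewrite addrA subrK len -invrN -(ltr0_norm olt0) le_div//.
apply/funext => h; rewrite indicE /between mem_setE in_itv/=.
by rewrite ler_ndivrMr// ler_ndivlMr// lerBlDl lerBrDl (mulrC o) andbC.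
Qed.

Lemma mean_le_ge G S c : (forall h, a <= h <= b -> c <= G h) -> mean_le G S ->
  c * (b - a) <= S.
Proof.
move=> cG [Gi GS]; rewrite (le_trans _ GS)//.
have [ci _] := mean_le_cst c.
have -> : c * (b - a) = \int[mu]_(h in `[a, b]) c.
  rewrite Rintegral_cst//= lebesgue_measure_itv/= lte_fin; case: ltP => //= ba.
  by rewrite (_ : b = a) ?subrr//; apply/eqP; rewrite eq_le ba.
by apply: le_Rintegral => // h; rewrite /= in_itv/=; exact: cG.
Qed.

End Averaging.

(** * Comparison of the two signals at a point of the window *)

Section Comparison.
Context {R : realType}.
Local Notation mu := (@lebesgue_measure R).
Local Notation integrableT f := (mu.-integrable [set: R] (EFin \o f)).
Variables (alpha Omega theta DC T t0 sigma : R) (n : nat).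
Variables (A1 B1 A2 B2 : R -> R) (tau tau' : nat -> R).
Hypotheses (alpha0 : 0 < alpha) (alphaO : alpha <= Omega) (O1 : 1 <= Omega).
Hypotheses (theta0 : 0 < theta) (DC0 : 0 <= DC).
Hypotheses (sigma0 : 0 <= sigma) (DCs : DC <= theta * expR sigma).
Hypotheses (A1i : integrableT A1) (B1i : integrableT B1).
Hypotheses (A2i : integrableT A2) (B2i : integrableT B2).

Let high : set R := [set xi : R | Omega < `|xi|].
Hypothesis tail1 :
  \int[mu]_(xi in high) (`|A1 xi| + `|B1 xi|) <= 2 * theta.
Hypothesis tail2 :
  \int[mu]_(xi in high) (`|A2 xi| + `|B2 xi|) <= 2 * theta.

Let V1 := leak alpha A1 B1.
Let V2 := leak alpha A2 B2.
Let S t := \sum_(0 <= j < n)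
  (alpha * `|tau j.+1 - tau' j.+1| + between (tau j.+1) (tau' j.+1) t).
Let Delta := \sum_(0 <= j < n) `|tau j.+1 - tau' j.+1|.

Hypothesis V_dist : forall t, `|V1 t - V2 t| <=
  2 * theta + theta * S t + (if t0 <= t <= T then 2 * theta else 4 * DC).

Variable x : R.
Hypothesis x_in :
  t0 + 4 / Omega * sigma ^+ 2 <= x <= T - 4 / Omega * sigma ^+ 2.

(** At least [sigma], so that [m] gains of 1/4 absorb [exp sigma]; at most [sigma + 1], so that
    samples outside the window are already in the range of decay; positive even for [sigma = 0]. *)
Let m : nat := (Num.trunc sigma).+1.
Let weight : nat -> R := wave_weight m (4 * m%:R)^-1.

Let O0 : 0 < Omega. Proof. exact: lt_le_trans O1. Qed.
Let p0 := @pi_gt0 R.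

Let sigma_le_m : sigma <= m%:R.
Proof. by rewrite ltW// /m truncnS_gt. Qed.

Let m_le_sigma : m%:R <= sigma + 1.
Proof. by rewrite /m -natr1 lerD2r truncn_le. Qed.

Let S_ge0 t : 0 <= S t.
Proof.
apply: sumr_ge0 => j _; rewrite addr_ge0 ?ler0n// mulr_ge0//; exact: ltW.
Qed.

(** A sample outside [[t0, T]] is at distance at least [4 sigma^2 / Omega] from [x]. As
    [h <= 1 / (4 pi Omega)], this means [odd_coef k >= 16 pi sigma^2 >= 32 sigma^2], so the weight
    turns [4 DC] into [16 theta]; and [18 = 2 + 16]. *)
Let weight_V_dist k h y : h <= (4 * pi * Omega)^-1 ->
  `|y - x| = odd_coef k * h ->
  `|weight k| * `|V1 y - V2 y| <=
  (odd_coef k ^+ 2)^-1 * (18 * theta + theta * S y).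
Proof.
move=> hO yx.
have wk : `|weight k| <= (odd_coef k ^+ 2)^-1 by exact: wave_weight_le.
have th2 : 0 <= 2 * theta + theta * S y.
  by rewrite addr_ge0 ?mulr_ge0 ?(ltW theta0).
have near_part : `|weight k| * (2 * theta + theta * S y) <=
    (odd_coef k ^+ 2)^-1 * (2 * theta + theta * S y) by rewrite ler_wpM2r.
have inv0 : 0 <= (odd_coef k ^+ 2)^-1 :> R by rewrite invr_ge0 sqr_ge0.
rewrite (le_trans (ler_wpM2l (normr_ge0 _) (V_dist y)))// mulrDr.
have -> : 18 * theta + theta * S y = 2 * theta + theta * S y + 16 * theta by ring.
rewrite [leRHS]mulrDr lerD//; case: ifPn => [_|far].
  by rewrite ler_pM ?mulr_ge0 ?(ltW theta0)// ler_wpM2r ?(ltW theta0)//; lra.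
have w_le : 4 / Omega * sigma ^+ 2 <= `|y - x|.
  rewrite leNgt; apply/negP => yx_lt; move/negP: far; apply.
  move: yx_lt; rewrite ltr_norml; move: x_in; lra.
have far_k : 32 * sigma ^+ 2 <= odd_coef k.
  have : 4 / Omega * sigma ^+ 2 * (4 * pi * Omega) <= odd_coef k.
    rewrite -ler_pdivlMr ?mulr_gt0// (le_trans w_le)// yx ler_wpM2l//.
  have -> : 4 / Omega * sigma ^+ 2 * (4 * pi * Omega) = 16 * pi * sigma ^+ 2.
    by have := lt0r_neq0 O0; move: (pi : R) => p O0'; field.
  apply: le_trans; rewrite ler_wpM2r ?sqr_ge0//; have := @pi_ge2 R; lra.
have := wave_weight_far m k sigma theta DC _ sigma0 theta0 DC0 DCs
  m_le_sigma sigma_le_m far_k.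
by rewrite -/(weight k) => /(_ isT); lra.
Qed.

Let eps (N : nat) : R := 2 / alpha * (16 * pi * Omega + 8 * alpha) *
  ((cos 1) ^- 2 / N.*2%:R) *
  (\int[mu]_xi (`|A1 xi| + `|B1 xi|) + \int[mu]_xi (`|A2 xi| + `|B2 xi|)).

(** Weighted count of the displaced spikes met by the samples: the part of the error that depends on
    [h] and is controlled only on average. *)
Let jitter (N : nat) h : R := \sum_(0 <= k < N.*2) (odd_coef k ^+ 2)^-1 *
  \sum_(0 <= j < n) (between (tau j.+1) (tau' j.+1) (x + odd_coef k * h) +
                     between (tau j.+1) (tau' j.+1) (x + (- odd_coef k) * h)).

(** [244 = 61 * (2 + 2)] collects the high frequencies of both signals, [108 = 36 * 3] the
    coefficient bound times the sum of [1 / (2k+1)^2], and [36 = 18 + 18] the right and left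
    samples. *)
Let synthesis_dist_h N h : (0 < N)%N ->
  (8 * pi * Omega)^-1 <= h <= (4 * pi * Omega)^-1 ->
  `|synthesis A1 B1 x - synthesis A2 B2 x| <=
  eps N + 244 * theta + 108 * Omega * (36 * theta + 2 * theta * (alpha * Delta)) +
  36 * Omega * theta * jitter N h.
Proof.
move=> N0 /andP[Oh hO].
have h0 : 0 < h by apply: lt_le_trans Oh; rewrite invr_gt0 !mulr_gt0.
have mgt0 : (0 < m)%N by [].
have e1 := stencil_error m N alpha h Omega mgt0 N0 alpha0 alphaO hO Oh
  A1 B1 A1i B1i x.
have e2 := stencil_error m N alpha h Omega mgt0 N0 alpha0 alphaO hO Oh
  A2 B2 A2i B2i x.
set st1 := stencil _ _ _ _ _ _ in e1; set st2 := stencil _ _ _ _ _ _ in e2.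
have sd : `|st1 - st2| <=
    108 * Omega * (36 * theta + 2 * theta * (alpha * Delta)) +
    36 * Omega * theta * jitter N h.
  have termwise : `|st1 - st2| <= \sum_(0 <= k < N.*2) 36 * Omega *
      ((odd_coef k ^+ 2)^-1 * (36 * theta + 2 * theta * (alpha * Delta)) +
       theta * ((odd_coef k ^+ 2)^-1 * \sum_(0 <= j < n)
         (between (tau j.+1) (tau' j.+1) (x + odd_coef k * h) +
          between (tau j.+1) (tau' j.+1) (x + (- odd_coef k) * h)))).
    rewrite /st1 /st2 /stencil -sumrB (le_trans (ler_norm_sum _ _ _))//.
    apply: ler_sum => k _.
    have [cr cl] := stencil_coef_le m N alpha h Omega N0 alpha0 alphaO Oh k.
    have ok := @odd_coef_gt0 R k.
    have d1 := weight_V_dist k h (x + odd_coef k * h) hO _.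
    have d2 := weight_V_dist k h (x - odd_coef k * h) hO _.
    have {}d1 := d1 (ltac:(by rewrite addrC addKr gtr0_norm// mulr_gt0)).
    have {}d2 := d2 (ltac:(by rewrite addrC addKr normrN gtr0_norm// mulr_gt0)).
    set sr := stencil_right _ _ _ _ _ in cr *.
    set sl := stencil_left _ _ _ _ _ in cl *.
    set yr := x + _ * h in d1 *; set yl := x - _ * h in d2 *.
    have -> : sr * leak alpha A1 B1 yr + sl * leak alpha A1 B1 yl -
        (sr * leak alpha A2 B2 yr + sl * leak alpha A2 B2 yl) =
        sr * (V1 yr - V2 yr) + sl * (V1 yl - V2 yl) by rewrite /V1 /V2; ring.
    have b1 : `|sr * (V1 yr - V2 yr)| <=
        36 * Omega * ((odd_coef k ^+ 2)^-1 * (18 * theta + theta * S yr)).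
      rewrite normrM (le_trans (ler_wpM2r _ cr))// -[leLHS]mulrA.
      by rewrite ler_wpM2l// mulr_ge0// ltW.
    have b2 : `|sl * (V1 yl - V2 yl)| <=
        36 * Omega * ((odd_coef k ^+ 2)^-1 * (18 * theta + theta * S yl)).
      rewrite normrM (le_trans (ler_wpM2r _ cl))// -[leLHS]mulrA.
      by rewrite ler_wpM2l// mulr_ge0// ltW.
    rewrite (le_trans (ler_normD _ _))// (le_trans (lerD b1 b2))//.
    rewrite le_eqVlt; apply/orP; left; apply/eqP.
    rewrite mulNr -/yr -/yl [in RHS]big_split/= /S !big_split/= -!mulr_sumr.
    by rewrite -/Delta; ring.
  rewrite (le_trans termwise)// -mulr_sumr big_split/= -mulr_suml -mulr_sumr.
  rewrite -/(jitter N h).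
  set E := 36 * theta + _.
  have E0 : 0 <= E.
    rewrite /E addr_ge0 ?mulr_ge0 ?(ltW theta0) ?(ltW alpha0)//.
    by apply: sumr_ge0 => j _.
  have := ler_wpM2r E0 (@sum_odd_coef_le R N.*2).
  move=> /(ler_wpM2l (_ : 0 <= 36 * Omega)); rewrite mulr_ge0 ?(ltW O0)// => /(_ isT).
  lra.
have -> : synthesis A1 B1 x - synthesis A2 B2 x = (synthesis A1 B1 x - st1) -
  (synthesis A2 B2 x - st2) + (st1 - st2) by ring.
rewrite (le_trans (ler_normD _ _))//.
have e12 := le_trans (ler_normB _ _) (lerD e1 e2).
have : eps N + 244 * theta >= `|synthesis A1 B1 x - st1 - (synthesis A2 B2 x - st2)|.
  rewrite (le_trans e12)// /eps; move: tail1 tail2; rewrite /high.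
  set c := _ * (_ / _); lra.
by move: sd; lra.
Qed.

Let Delta_ge0 : 0 <= Delta. Proof. exact: sumr_ge0. Qed.

Let synthesis_dist_N N : (0 < N)%N ->
  `|synthesis A1 B1 x - synthesis A2 B2 x| <=
  eps N + 7200 * theta * Omega * (1 + Omega * Delta).
Proof.
(* The steps fill [[a, 2 a]], of length [a]. Dividing the mean by this length costs
   [8 pi Omega <= 32 Omega], the source of the second factor [Omega] on [Delta]. *)
move=> N0; pose a := (8 * pi * Omega)^-1 : R; pose b := (4 * pi * Omega)^-1 : R.
have a0 : 0 < a by rewrite invr_gt0 !mulr_gt0.
have ba : b - a = a.
  rewrite /a /b; have := lt0r_neq0 O0; move: (pi : R) p0 => p /lt0r_neq0 p0' O0'.
  by field; rewrite ?p0' ?O0'.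
have ab : a <= b by rewrite -subr_ge0 ba ltW.
have jit k : mean_le a b (fun h => \sum_(0 <= j < n)
    (between (tau j.+1) (tau' j.+1) (x + odd_coef k * h) +
     between (tau j.+1) (tau' j.+1) (x + (- odd_coef k) * h))) (2 * Delta).
  have -> : 2 * Delta = \sum_(0 <= j < n)
      (`|tau j.+1 - tau' j.+1| + `|tau j.+1 - tau' j.+1|).
    by rewrite big_split/= mulr_natl mulr2n.
  apply: mean_le_sum => // j.
  apply: mean_le_add; apply: mean_le_between; rewrite ?normrN//.
    by rewrite gtr0_norm ?odd_coef_gt0 ?odd_coef_ge1.
  by rewrite gtr0_norm ?odd_coef_gt0 ?odd_coef_ge1.
pose c0 := eps N + 244 * theta +
  108 * Omega * (36 * theta + 2 * theta * (alpha * Delta)).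
have mean := mean_le_add a b _ _ _ _ (mean_le_cst a b ab c0)
  (mean_le_scale a b (36 * Omega * theta) _ _
    (_ : 0 <= 36 * Omega * theta)
    (mean_le_sum a b ab N.*2 _ _ (fun k => mean_le_scale a b
      (odd_coef k ^+ 2)^-1 _ _ (_ : 0 <= (odd_coef k ^+ 2)^-1) (jit k)))).
have {}mean := mean (ltac:(by rewrite !mulr_ge0 ?(ltW O0) ?(ltW theta0)))
  (fun k => ltac:(by rewrite invr_ge0 sqr_ge0)).
have := mean_le_ge a b ab _ _ `|synthesis A1 B1 x - synthesis A2 B2 x|
  (fun h hh => synthesis_dist_h N h N0 hh) mean.
rewrite -mulr_suml ba -ler_pdivlMr// => /le_trans; apply.
rewrite mulrDl mulfK ?gt_eqF//.
have sumD : \sum_(0 <= k < N.*2) (odd_coef k ^+ 2)^-1 * (2 * Delta) <=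
    3 * (2 * Delta).
  by rewrite -mulr_suml ler_wpM2r ?mulr_ge0 ?sum_odd_coef_le.
have ainv : a^-1 <= 32 * Omega.
  rewrite /a invrK ler_wpM2r ?(ltW O0)//; have := @pihalf_lt2 R; lra.
have OOt : 0 <= Omega * theta by rewrite mulr_ge0 ?(ltW O0) ?(ltW theta0).
have last_term : 36 * Omega * theta *
    ((\sum_(0 <= k < N.*2) (odd_coef k ^+ 2)^-1) * (2 * Delta)) / a <=
    6912 * (Omega * theta * (Omega * Delta)).
  have -> : 6912 * (Omega * theta * (Omega * Delta)) =
      36 * Omega * theta * (3 * (2 * Delta)) * (32 * Omega) by ring.
  apply: ler_pM => //.
  - rewrite !mulr_ge0 ?(ltW O0) ?(ltW theta0)//.
    by apply: sumr_ge0 => k _; rewrite invr_ge0 sqr_ge0.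
  - by rewrite invr_ge0 ltW.
  rewrite ler_wpM2l ?mulr_ge0 ?(ltW O0) ?(ltW theta0)// ler_wpM2r ?mulr_ge0//.
  exact: sum_odd_coef_le.
rewrite (le_trans (lerD (lexx _) last_term))// /c0.
(* The totals are [244 + 108 * 36 = 4132] for the constant term and [216 + 6912 = 7128] for the
   [Delta] term; 7200 exceeds both. *)
have tO : theta <= Omega * theta by rewrite ler_peMl// ltW.
have aD : Omega * theta * (alpha * Delta) <= Omega * theta * (Omega * Delta).
  by rewrite ler_wpM2l// ler_wpM2r.
have D0 : 0 <= Omega * theta * (Omega * Delta) by rewrite !mulr_ge0// ltW.
lra.
Qed.

Lemma synthesis_dist : `|synthesis A1 B1 x - synthesis A2 B2 x| <=
  7200 * theta * Omega * (1 + Omega * Delta).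
Proof.
apply/ler_addgt0Pr => e e0.
pose E := 2 / alpha * (16 * pi * Omega + 8 * alpha) * (cos 1) ^- 2 *
  (\int[mu]_xi (`|A1 xi| + `|B1 xi|) + \int[mu]_xi (`|A2 xi| + `|B2 xi|)).
(* Then [E / e <= N], so the truncation error [E / (2 N)] is below [e]. *)
pose N := (Num.trunc (E / e)).+1.
have N0 : 0 < N%:R :> R by rewrite ltr0n.
have N_big : E / e <= N%:R by rewrite ltW// truncnS_gt.
rewrite (le_trans (synthesis_dist_N N isT))// addrC lerD2l.
have -> : eps N = E / (2 * N%:R).
  rewrite /eps /E -muln2 natrM; field.
  by rewrite gt_eqF// !gt_eqF// cos1_gt0.
rewrite ler_pdivrMr ?mulr_gt0//.
move: N_big; rewrite ler_pdivrMr// => N_big.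
have : 0 <= N%:R * e by rewrite mulr_ge0// ltW.
lra.
Qed.

End Comparison.

(** * Essential suprema, the tail of the transform, and the final estimate *)

Section Assembly.
Context {R : realType}.
Local Notation mu := (@lebesgue_measure R).

Lemma modulus_ge0 (z : R[i]) : 0 <= modulus z.
Proof. by rewrite modulusE sqrtr_ge0. Qed.

Lemma Linfty_norm_le (a b M : R) (f : R -> R[i]) : 0 <= M ->
  {ae mu, forall x, a <= x <= b -> modulus (f x) <= M} ->
  (Linfty_norm a b f <= M%:E)%E.
Proof.
move=> M0 [N [mN N0 fN]]; rewrite /Linfty_norm unlock.
case: ifPn => _; last by rewrite lee_fin.
(* The complement of [[a, b]] is null for the restricted measure, so it can be added to the
   exceptional set. *)
apply/ess_supP; exists (N `|` ~` `[a, b]); split.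
- by apply: measurableU => //; exact: measurableC.
- rewrite /= /mrestr setIUl setICl setU0.
  apply/eqP; rewrite eq_le measure_ge0 andbT -N0 le_measure ?inE//.
  exact: measurableI.
- move=> x /= fx; have [xab|xab] := boolP (x \in `[a, b]); last first.
    by right; exact/negP.
  left; apply: fN => /= xM; apply: fx.
  rewrite lee_fin ger0_norm; last exact: modulus_ge0.
  by apply: xM; move: xab; rewrite in_itv.
Qed.

Lemma ae_imply2 (P Q S : R -> Prop) : (forall x, P x -> Q x -> S x) ->
  {ae mu, forall x, P x} -> {ae mu, forall x, Q x} -> {ae mu, forall x, S x}.
Proof.
move=> PQS aP aQ; apply: negligibleS (negligibleU aP aQ) => x /= nS.
by have [Px|nP] := pselect (P x); [right => Qx; apply: nS; exact: PQS|left].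
Qed.

Lemma high_frequency_part (b : bool) (Omega theta : R) (g : R -> R[i]) :
  cintegrable g ->
  (\int[mu]_(xi in [set xi : R | (Omega < `|xi|)%R]) (modulus (g xi))%:E
     <= theta%:E)%E ->
  \int[mu]_(xi in [set xi : R | Omega < `|xi|])
    (`|fourier_cos b g xi| + `|fourier_sin b g xi|) <= 2 * theta.
Proof.
move=> gi tail; set high := [set xi : R | _].
have mhigh : measurable high.
  rewrite (_ : high = (fun x : R => `|x|) @^-1` `]Omega, +oo[%classic).
    by rewrite -[_ @^-1` _]setTI; exact: normr_measurable.
  by apply/seteqP; split => x /=; rewrite in_itv/= andbT.
have ABi := integrable_norm_add _ _ (integrable_fourier_cos b g gi)
  (integrable_fourier_sin b g gi).
have mm : measurable_fun [set: R] (fun xi => modulus (g xi)).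
  rewrite (_ : (fun xi => _) = (fun y => Num.sqrt y) \o
      (fun xi => part false (g xi) ^+ 2 + part true (g xi) ^+ 2)); last first.
    by apply/funext => xi; rewrite /= modulusE.
  apply: measurableT_comp.
    by apply: continuous_measurable_fun => y; exact: sqrt_continuous.
  apply: measurable_funD; apply: measurable_funX.
    exact: integrable_measurable gi.1.
  exact: integrable_measurable gi.2.
have le : (\int[mu]_(xi in high)
    (`|fourier_cos b g xi| + `|fourier_sin b g xi|)%:E <= (2 * theta)%:E)%E.
  rewrite EFinM (le_trans _ (lee_wpmul2l _ tail))// ?lee_fin//.
  rewrite -ge0_integralZl//; last 2 first.
  - by apply/measurable_EFinP; exact: measurable_funTS.
  - by move=> xi _; rewrite lee_fin modulus_ge0.
  apply: ge0_le_integral => //.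
  - apply/measurable_EFinP; apply: measurable_funTS.
    exact: integrable_measurable ABi.
  - apply/measurable_EFinP; apply: measurable_funTS.
    exact: measurable_funM.
  move=> xi _; rewrite lee_fin mulr_natl mulr2n lerD//.
    exact: fourier_cos_le.
  exact: fourier_sin_le.
rewrite -lee_fin /Rintegral fineK// ge0_fin_numE.
  by rewrite (le_lt_trans le)// ltry.
by apply: integral_ge0 => xi _; rewrite lee_fin addr_ge0.
Qed.

Lemma lif_train_eq alpha theta T DC n u (tau q q' : nat -> R) :
  (forall k, (k < n)%N -> q k = q' k) ->
  lif_train alpha theta T DC n u tau q -> lif_train alpha theta T DC n u tau q'.
Proof.
by move=> qq' [*]; split => // k kn; rewrite -qq'//; auto.
Qed.

Lemma firing_time_tnth n (s : n.-tuple R) (j : 'I_n) :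
  firing_time s j.+1 = tnth s j.
Proof. by rewrite /firing_time /= (tnth_nth 0). Qed.

End Assembly.

Theorem theorem2p2 (R : realType) :
  exists C : R, 0 < C /\
  forall (T theta alpha0 Dalpha alpha Omega DC : R)
    (class : set (R -> R[i])) (n : nat) (f1 f2 : R -> R[i])
    (s s' : n.-tuple R),
  0 < T -> 0 < theta ->
  0 < alpha0 -> 0 <= Dalpha -> 0 < alpha0 - Dalpha ->
  alpha0 - Dalpha <= alpha <= alpha0 + Dalpha ->
  1 <= Omega -> 0 <= DC ->
  (forall f, class f -> signal f) ->
  (forall f, class f -> has_bandwidth Omega theta f) ->
  (forall f, class f ->
     (past_uncertainty alpha0 Dalpha f <= DC%:E)%E /\
     (future_uncertainty theta alpha T alpha0 Dalpha f <= DC%:E)%E) ->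
  alpha0 + Dalpha <= Omega ->
  class f1 -> class f2 ->
  lif_spikes theta alpha T f1 s ->
  lif_spikes theta alpha T f2 s' ->
  (forall j : 'I_n, firing_phase alpha f1 s j = firing_phase alpha f2 s' j) ->
  let Dt : R := \sum_(j < n) `|tnth s j - tnth s' j| in
  let sigma : R := logp (DC / theta) in
  let T1 : R := sigma / (alpha0 - Dalpha) + 4 / Omega * sigma ^+ 2 in
  let T2 : R := T - 4 / Omega * sigma ^+ 2 in
  (Linfty_norm T1 T2 (fun x => f1 x - f2 x)%R <=
    (C * theta * Omega *
      (1 + n%:R * (Dalpha / (alpha0 - Dalpha)) + Dt * n%:R * Omega))%:E)%E.
Proof.
(* The bound of [synthesis_dist] for one real component, kept abstract; the factor 2 below adds the
   two components. *)
have [c [c0 cE]] : exists c : R, 0 < c /\ c = 7200 by exists 7200; rewrite ltr0n.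
exists (2 * c); split; first by rewrite mulr_gt0.
move=> T theta alpha0 Dalpha alpha Omega DC class n f1 f2 s s'.
move=> T0 th0 a00 Da0 aD0 /andP[aDl aDu] O1 DC0 Csig Cband Cunc aO cf1 cf2.
move=> sL sL' qE.
pose Dt := \sum_(j < n) `|tnth s j - tnth s' j|.
pose sigma := logp (DC / theta).
pose T1 := sigma / (alpha0 - Dalpha) + 4 / Omega * sigma ^+ 2.
pose T2 := T - 4 / Omega * sigma ^+ 2.
change ((Linfty_norm T1 T2 (fun x => f1 x - f2 x)%R <= (2 * c * theta * Omega *
  (1 + n%:R * (Dalpha / (alpha0 - Dalpha)) + Dt * n%:R * Omega))%:E)%E).
have alpha_gt0 : 0 < alpha by exact: lt_le_trans aDl.
have alphaO : alpha <= Omega by exact: le_trans aO.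
have alphaD : `|alpha - alpha0| <= Dalpha by rewrite ler_norml; lra.
have O0 : 0 < Omega by exact: lt_le_trans O1.
have [fS1 fS2] := (Csig _ cf1, Csig _ cf2).
have [[g1 [fg1 tail1]] [g2 [fg2 tail2]]] := (Cband _ cf1, Cband _ cf2).
have [[past1 fut1] [past2 fut2]] := (Cunc _ cf1, Cunc _ cf2).
have sigma0 : 0 <= sigma by rewrite le_max lexx.
have DCs : DC <= theta * expR sigma by exact: le_expR_logp.
(* Since [alpha >= alpha0 - Dalpha], this gives [alpha t0 >= sigma]: by time [t0] the memory of the
   past has shrunk from [DC] to [theta]. *)
pose t0 := sigma / (alpha0 - Dalpha).
have t00 : 0 <= t0 by rewrite divr_ge0// ltW.
have DCt0 : DC * expR (- (alpha * t0)) <= theta.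
  rewrite expRN ler_pdivrMr ?expR_gt0// (le_trans DCs)//.
  rewrite ler_wpM2l ?(ltW th0)// ler_expR /t0 mulrCA ler_peMr//.
  by rewrite ler_pdivlMr// mul1r.
have Dt_nat : Dt = \sum_(0 <= j < n) `|firing_time s j.+1 - firing_time s' j.+1|.
  by rewrite big_mkord; apply: eq_bigr => j _; rewrite !firing_time_tnth.
have bound b : {ae lebesgue_measure, forall x : R, T1 <= x <= T2 ->
    `|part b (f1 x - f2 x)| <= c * theta * Omega * (1 + Omega * Dt)}.
  have train1 := lif_train_part f1 g1 alpha theta T fS1 fg1 alpha_gt0 th0
    alpha0 Dalpha DC alphaD past1 fut1 b s T0 sL.
  have := lif_train_part f2 g2 alpha theta T fS2 fg2 alpha_gt0 th0
    alpha0 Dalpha DC alphaD past2 fut2 b s' T0 sL'.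
  move: train1; rewrite !size_tuple => train1 train2.
  have phaseE k : (k < n)%N -> part b (firing_phase alpha f2 s' k) =
      part b (firing_phase alpha f1 s k).
    by move=> kn; rewrite -(qE (Ordinal kn)).
  (* Both trains now carry literally the same phases, so that their sums differ only through the
     spike times. *)
  have {}train2 := lif_train_eq _ _ _ _ _ _ _ _ _ phaseE train2.
  have e1 : past_part f1 b alpha = leak alpha (fourier_cos b g1) (fourier_sin b g1).
    by apply/funext => t; exact: past_part_leak.
  have e2 : past_part f2 b alpha = leak alpha (fourier_cos b g2) (fourier_sin b g2).
    by apply/funext => t; exact: past_part_leak.
  rewrite e1 in train1; rewrite e2 in train2.
  have q1 j : (j < n)%N -> `|part b (firing_phase alpha f1 s j)| <= 1.
    by move=> jn; apply: (part_phase_le1 f1 alpha theta T th0 b s) => //;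
      rewrite size_tuple.
  have nT : firing_time s n <= T.
    by apply: (firing_time_le_T f1 alpha theta T s) => //; rewrite size_tuple.
  have nT' : firing_time s' n <= T.
    by apply: (firing_time_le_T f2 alpha theta T s') => //; rewrite size_tuple.
  have dist t := train_dist alpha theta T DC n _ _ _ _ _ t0 t alpha_gt0
    (ltW th0) DC0 train1 train2 nT nT' q1 t00 DCt0.
  have ci1 := fg1.1; have ci2 := fg2.1.
  have key x xT := synthesis_dist alpha Omega theta DC T t0 sigma n _ _ _ _ _ _
    alpha_gt0 alphaO O1 th0 DC0 sigma0 DCs
    (integrable_fourier_cos b g1 ci1) (integrable_fourier_sin b g1 ci1)
    (integrable_fourier_cos b g2 ci2) (integrable_fourier_sin b g2 ci2)
    (high_frequency_part b Omega theta g1 ci1 tail1)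
    (high_frequency_part b Omega theta g2 ci2 tail2) dist x xT.
  apply: ae_imply2 (part_synthesis f1 g1 b fS1 fg1)
    (part_synthesis f2 g2 b fS2 fg2) => x f1E f2E xT.
  by rewrite partB f1E f2E Dt_nat cE; exact: key.
have Dt0 : 0 <= Dt by exact: sumr_ge0.
have DtO : Omega * Dt <= Dt * n%:R * Omega.
  rewrite mulrC ler_wpM2r ?(ltW O0)// /Dt.
  (* Without spikes both sides vanish; otherwise the factor [n] is at least 1. *)
  case: (n) s s' @Dt {sL sL' qE Dt_nat bound Dt0} => [|k] s s' /=.
    by rewrite big_ord0 mul0r.
  by rewrite ler_peMr ?sumr_ge0// ler1n.
have ratio0 : 0 <= n%:R * (Dalpha / (alpha0 - Dalpha)).
  by rewrite mulr_ge0 ?divr_ge0// ltW.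
have final : c * theta * Omega * (1 + Omega * Dt) +
    c * theta * Omega * (1 + Omega * Dt) <= 2 * c * theta * Omega *
    (1 + n%:R * (Dalpha / (alpha0 - Dalpha)) + Dt * n%:R * Omega).
  have -> (z : R) : c * theta * Omega * z + c * theta * Omega * z =
      2 * c * theta * Omega * z by ring.
  by rewrite ler_wpM2l ?mulr_ge0 ?(ltW c0) ?(ltW th0) ?(ltW O0)//; lra.
apply: Linfty_norm_le.
  apply: le_trans final.
  by rewrite addr_ge0// !mulr_ge0 ?addr_ge0 ?mulr_ge0 ?(ltW c0) ?(ltW th0) ?(ltW O0).
apply: ae_imply2 (bound false) (bound true) => x b1 b2 xT.
rewrite (le_trans (modulus_le_parts _))// (le_trans _ final)// lerD//.
  exact: b1.
exact: b2.
Qed.
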